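(* Let $(M,g)$ be a complete connected Riemannian manifold of dimension $n$ and let $\alpha$ be a smooth real differential $1$-form on $M$. Then for all $f\in C^\infty(M,\mathbb{C})$, pointwise on $M$, $$\begin{aligned}-\tfrac12\Delta\big(|\mathrm{grad}^\alpha f|^2\big)=\ &|\mathrm{Hess}^\alpha f|^2-\tfrac12\big(\langle\mathrm{grad}^\alpha f,\mathrm{grad}^\alpha(\Delta^\alpha f)\rangle+\langle\mathrm{grad}^\alpha(\Delta^\alpha f),\mathrm{grad}^\alpha f\rangle\big)\\&+\mathrm{Ric}(\mathrm{grad}^\alpha f,\mathrm{grad}^\alpha f)+i\big(d\alpha(\mathrm{grad}^\alpha f,\overline{\mathrm{grad}^\alpha f})-d\alpha(\overline{\mathrm{grad}^\alpha f},\mathrm{grad}^\alpha f)\big)\\&+\tfrac i2\big(\langle\overline f\,\mathrm{grad}^\alpha f,(\delta d\alpha)^\sharp\rangle-\langle f\,\overline{\mathrm{grad}^\alpha f},(\delta d\alpha)^\sharp\rangle\big),\end{aligned}$$ where $\delta$ is the formal adjoint of the exterior derivative on $(M,g)$.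
   Context: $\langle\cdot,\cdot\rangle$ is the Hermitian extension of $g$ to $TM\otimes\mathbb{C}$ and $T^*M\otimes\mathbb{C}$, complex linear in the first and conjugate linear in the second entry; $|X|^2=\langle X,X\rangle$. The musical isomorphism $\sharp:T^*M\otimes\mathbb{C}\to TM\otimes\mathbb{C}$ is the complex linear one with $w(X)=\langle X,\overline{w^\sharp}\rangle$. The Levi-Civita connection $\nabla$ and the forms $\alpha,d\alpha$ are extended complex (multi)linearly. $\mathrm{grad} f=(df)^\sharp$ and $\Delta=-\mathrm{div}\,\mathrm{grad}$ is the (nonnegative) Laplace–Beltrami operator. For $f\in C^\infty(M,\mathbb{C})$: $d^\alpha f=df+if\alpha$; the magnetic gradient is $\mathrm{grad}^\alpha f=(d^\alpha f)^\sharp=\mathrm{grad} f+if\alpha^\sharp$; the magnetic divergence of a complex vector field $X$ is $\mathrm{div}^\alpha X=\mathrm{div}X+i\langle X,\alpha^\sharp\rangle$; the magnetic Laplacian is $\Delta^\alpha f=(d^\alpha)^*d^\alpha f=-\mathrm{div}^\alpha\mathrm{grad}^\alpha f$. The magnetic covariant derivative is $\nabla^\alpha_YX=\nabla_YX+i\alpha(Y)X$; the magnetic Hessian is $\mathrm{Hess}^\alpha f(X,Y)=\langle\nabla^\alpha_X\mathrm{grad}^\alpha f,Y\rangle$, with $|\mathrm{Hess}^\alpha f|^2=\sum_{j=1}^n|\nabla^\alpha_{e_j}\mathrm{grad}^\alpha f|^2$ for a real orthonormal basis $e_1,\dots,e_n$ of $T_pM$. $\mathrm{Ric}$ is the Ricci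 tensor (positive on round spheres) extended Hermitian-sesquilinearly, i.e. $\mathrm{Ric}(a+ib,a+ib)=\mathrm{Ric}(a,a)+\mathrm{Ric}(b,b)$ for real $a,b$. The exterior derivative is normalized by $d\alpha(X,Y)=X(\alpha(Y))-Y(\alpha(X))-\alpha([X,Y])$, and $(\delta d\alpha)(Y)=-\sum_{j=1}^n(\nabla_{e_j}d\alpha)(e_j,Y)$. *)

(* Defs.v *)
From HB Require Import structures.
From mathcomp Require Import all_boot all_order all_algebra.
From mathcomp Require Import complex ring.
From mathcomp Require Import all_classical all_reals all_analysis.

Set Implicit Arguments.
Unset Strict Implicit.
Unset Printing Implicit Defensive.

Import Order.TTheory GRing.Theory Num.Theory.
Import numFieldNormedType.Exports.

Local Open Scope classical_set_scope.
Local Open Scope ring_scope.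
Local Open Scope complex_scope.

(* Smooth manifolds are topological spaces with a smooth atlas.  Tensor fields
   are families of components, one for each chart, related by the
   usual transformation laws; the row-vector convention is used throughout, so
   that a tangent vector v changes to v *m 'J tau x under a transition map tau,
   where 'J is the Jacobian matrix of the library. *)

Section Smoothness.
Variables (R : realType) (n : nat).
Implicit Types (U : set 'rV[R]_n) (u : 'rV[R]_n -> R).

Definition partial u (i : 'I_n) (x : 'rV[R]_n) : R := 'D_(delta_mx 0 i) u x.

Fixpoint Ck (k : nat) U u : Prop :=
  (forall x, U x -> {for x, continuous u}) /\
  if k is k'.+1 then
    forall i : 'I_n, (forall x, U x -> derivable u x (delta_mx 0 i)) /\
                     Ck k' U (partial u i)
  else True.

Definition smooth_on U u : Prop := forall k, Ck k U u.

End Smoothness.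

Record chart (R : realType) (n : nat) (M : topologicalType) := Chart {
  cdom : set M;
  cmap : M -> 'rV[R]_n;
  cinv : 'rV[R]_n -> M;
  open_cdom : open cdom;
  open_cimg : open (cmap @` cdom);
  cmapK : forall p, cdom p -> cinv (cmap p) = p;
  cmap_continuous : forall p, cdom p -> {for p, continuous cmap};
  cinv_continuous : forall x, (cmap @` cdom) x -> {for x, continuous cinv}
}.

Section Transition.
Variables (R : realType) (n : nat) (M : topologicalType).
Implicit Types c d : chart R n M.

Definition cimg c : set 'rV[R]_n := cmap c @` cdom c.
Definition overlap c d : set 'rV[R]_n := cmap c @` (cdom c `&` cdom d).
Definition transition c d : 'rV[R]_n -> 'rV[R]_n := cmap d \o cinv c.

End Transition.

Record manifold (R : realType) (n : nat) := Manifold {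
  mspace :> topologicalType;
  atlas : set (chart R n mspace);
  manifold_hausdorff : hausdorff_space mspace;
  manifold_second_countable : @second_countable mspace;
  atlas_cover : forall p : mspace, exists2 c, atlas c & cdom c p;
  atlas_smooth : forall c d, atlas c -> atlas d -> forall k : 'I_n,
    smooth_on (overlap c d) (fun x => transition c d x 0 k)
}.

Record riemannian_metric (R : realType) (n : nat) (M : manifold R n) :=
  RiemannianMetric {
  gram : chart R n M -> 'rV[R]_n -> 'M[R]_n;
  gram_smooth : forall c, atlas c -> forall i j : 'I_n,
    smooth_on (cimg c) (fun x => gram c x i j);
  gram_sym : forall c, atlas c -> forall x, cimg c x ->
    (gram c x)^T = gram c x;
  gram_posdef : forall c, atlas c -> forall x, cimg c x ->
    forall v : 'rV[R]_n, v != 0 -> 0 < (v *m gram c x *m v^T) 0 0;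
  gram_transition : forall c d, atlas c -> atlas d ->
    forall x, overlap c d x ->
    gram c x = 'J (transition c d) x *m gram d (transition c d x)
               *m ('J (transition c d) x)^T
}.

Record one_form (R : realType) (n : nat) (M : manifold R n) := OneForm {
  coef : chart R n M -> 'rV[R]_n -> 'rV[R]_n;
  coef_smooth : forall c, atlas c -> forall i : 'I_n,
    smooth_on (cimg c) (fun x => coef c x 0 i);
  coef_transition : forall c d, atlas c -> atlas d ->
    forall x, overlap c d x ->
    coef c x = coef d (transition c d x) *m ('J (transition c d) x)^T
}.

Section ComplexFunctions.
Variables (R : realType) (n : nat) (M : manifold R n).

(* the expression of f : M -> C in the coordinates of c *)
Definition incoord (c : chart R n M) (f : M -> R[i]) : 'rV[R]_n -> R[i] :=
  f \o cinv c.

Definition smooth_fun (f : M -> R[i]) : Prop :=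
  forall c, atlas c ->
    smooth_on (cimg c) (fun x => complex.Re (incoord c f x)) /\
    smooth_on (cimg c) (fun x => complex.Im (incoord c f x)).

End ComplexFunctions.

(* Riemannian geometry on an open set of R^n with Gram matrix g.  All fields
   are complexified: a vector field is a map 'rV[R]_n -> 'rV[R[i]]_n giving the
   components in the coordinate frame, a 1-form likewise in the dual frame. *)
Section LocalGeometry.
Variables (R : realType) (n : nat) (g : 'rV[R]_n -> 'M[R]_n).
Implicit Types (x : 'rV[R]_n) (u f : 'rV[R]_n -> R[i]).
Implicit Types (X Y Z w : 'rV[R]_n -> 'rV[R[i]]_n).

Definition cvec (v : 'rV[R]_n) : 'rV[R[i]]_n := \row_i (v 0 i)%:C.
Definition frame (k : 'I_n) : 'rV[R]_n -> 'rV[R[i]]_n := cst (delta_mx 0 k).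
Definition conjv (v : 'rV[R[i]]_n) : 'rV[R[i]]_n := \row_i conjc (v 0 i).

Definition cpartial u (i : 'I_n) x : R[i] :=
  partial (fun y => complex.Re (u y)) i x +i*
  partial (fun y => complex.Im (u y)) i x.

(* X(u) *)
Definition deriv_along X u x : R[i] := \sum_i X x 0 i * cpartial u i x.

(* w(X) *)
Definition pairing w X x : R[i] := \sum_i w x 0 i * X x 0 i.

Definition lie X Y x : 'rV[R[i]]_n :=
  \row_k (deriv_along X (fun y => Y y 0 k) x
          - deriv_along Y (fun y => X y 0 k) x).

Definition hinner x (v w : 'rV[R[i]]_n) : R[i] :=
  \sum_i \sum_j (g x i j)%:C * v 0 i * conjc (w 0 j).

Definition normsq x (v : 'rV[R[i]]_n) : R[i] := hinner x v v.

Definition orthonormal_basis x (e : 'I_n -> 'rV[R]_n) : Prop :=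
  forall i j, (e i *m g x *m (e j)^T) 0 0 = (i == j)%:R.

Definition sharp x (w : 'rV[R[i]]_n) : 'rV[R[i]]_n :=
  \row_i \sum_j (invmx (g x) i j)%:C * w 0 j.

(* coefficient of d/dx_k in the covariant derivative of d/dx_j along d/dx_i *)
Definition christoffel (i j k : 'I_n) x : R :=
  2^-1 * \sum_l invmx (g x) k l *
    (partial (fun y => g y j l) i x + partial (fun y => g y i l) j x
     - partial (fun y => g y i j) l x).

(* the Levi-Civita connection: nabla Y X is the derivative of X along Y *)
Definition nabla Y X x : 'rV[R[i]]_n :=
  \row_k (deriv_along Y (fun y => X y 0 k) x
          + \sum_i \sum_j (christoffel i j k x)%:C * Y x 0 i * X x 0 j).

Definition differential u x : 'rV[R[i]]_n := \row_i cpartial u i x.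

Definition grad u x : 'rV[R[i]]_n := sharp x (differential u x).

(* trace of v |-> nabla v X *)
Definition divergence X x : R[i] := \sum_k nabla (frame k) X x 0 k.

Definition laplace u x : R[i] := - divergence (grad u) x.

Definition curvature X Y Z x : 'rV[R[i]]_n :=
  nabla X (nabla Y Z) x - nabla Y (nabla X Z) x - nabla (lie X Y) Z x.

(* Ric(v, w) = trace of z |-> curvature z v (conjugate of w), the vectors being
   extended with constant components; this is positive on round spheres. *)
Definition ricci x (v w : 'rV[R[i]]_n) : R[i] :=
  \sum_k curvature (frame k) (cst v) (cst (conjv w)) x 0 k.

Definition ext_d w X Y x : R[i] :=
  deriv_along X (pairing w Y) x - deriv_along Y (pairing w X) x
  - pairing w (lie X Y) x.

(* (nabla_Z dw)(X, Y) *)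
Definition nabla_ext_d w Z X Y x : R[i] :=
  deriv_along Z (ext_d w X Y) x - ext_d w (nabla Z X) Y x
  - ext_d w X (nabla Z Y) x.

(* the 1-form delta dw at x, where e is an orthonormal basis at x *)
Definition codiff_ext_d (e : 'I_n -> 'rV[R]_n) w x : 'rV[R[i]]_n :=
  \row_k - \sum_j nabla_ext_d w (cst (cvec (e j))) (cst (cvec (e j)))
                              (frame k) x.

Section Magnetic.
Variable a : 'rV[R]_n -> 'rV[R]_n.

Definition potential x : 'rV[R[i]]_n := cvec (a x).

Definition differentialA f x : 'rV[R[i]]_n :=
  differential f x + ('i%C * f x) *: potential x.

Definition gradA f x : 'rV[R[i]]_n := sharp x (differentialA f x).

Definition divergenceA X x : R[i] :=
  divergence X x + 'i%C * hinner x (X x) (sharp x (potential x)).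

Definition laplaceA f x : R[i] := - divergenceA (gradA f) x.

Definition nablaA Y X x : 'rV[R[i]]_n :=
  nabla Y X x + ('i%C * pairing potential Y x) *: X x.

(* |Hess^a f|^2 at x, where e is an orthonormal basis at x *)
Definition normsq_hessA (e : 'I_n -> 'rV[R]_n) f x : R[i] :=
  \sum_j normsq x (nablaA (cst (cvec (e j))) (gradA f) x).

End Magnetic.
End LocalGeometry.

Section Completeness.
Variables (R : realType) (n : nat) (M : manifold R n).
Variable g : riemannian_metric M.

Definition geodesic (gamma : R -> M) : Prop :=
  continuous gamma /\
  forall t c, atlas c -> cdom c (gamma t) ->
    let x (k : 'I_n) (s : R) : R := cmap c (gamma s) 0 k in
    forall k, [/\ derivable (x k) t 1, derivable (derive1 (x k)) t 1 &
      derive1 (derive1 (x k)) t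
      + \sum_i \sum_j christoffel (gram g c) i j k (cmap c (gamma t))
                      * derive1 (x i) t * derive1 (x j) t = 0].

(* every initial velocity v at every point p is that of a geodesic defined on
   the whole real line *)
Definition geodesically_complete : Prop :=
  forall c p (v : 'rV[R]_n), atlas c -> cdom c p ->
    exists gamma : R -> M, [/\ geodesic gamma, gamma 0 = p &
      forall k : 'I_n, derive1 (fun s => cmap c (gamma s) 0 k) 0 = v 0 k].

End Completeness.

(* The next lemmas justify the formulas used for sharp and christoffel. *)
Section Justification.
Variables (R : realType) (n : nat) (g : 'rV[R]_n -> 'M[R]_n).

Lemma posdef_unitmx (A : 'M[R]_n) :
  (forall v : 'rV[R]_n, v != 0 -> 0 < (v *m A *m v^T) 0 0) -> A \in unitmx.
Proof.
move=> Apos; rewrite -row_free_unit -kermx_eq0; apply/rowV0P => v /sub_kermxP vA.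
apply/eqP/negPn/negP => /Apos; by rewrite vA mul0mx mxE ltxx.
Qed.

Lemma sharpP (x : 'rV[R]_n) (w v : 'rV[R[i]]_n) :
  g x \in unitmx -> (g x)^T = g x ->
  \sum_i w 0 i * v 0 i = hinner g x v (conjv (sharp g x w)).
Proof.
move=> gU gS; rewrite /hinner; apply: eq_bigr => i _.
have -> : w 0 i = \sum_j (g x i j)%:C * sharp g x w 0 j.
  transitivity (\sum_k \sum_j (g x i j * invmx (g x) j k)%:C * w 0 k).
    transitivity (\sum_k ((1%:M : 'M[R]_n) i k)%:C * w 0 k).
      rewrite (bigD1 i) //= mxE eqxx mul1r big1 ?addr0 // => k ki.
      by rewrite mxE eq_sym (negbTE ki) mul0r.
    apply: eq_bigr => k _; rewrite -(mulmxV gU) mxE rmorph_sum /= mulr_suml.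
    by [].
  rewrite exchange_big /=; apply: eq_bigr => j _.
  rewrite mxE mulr_sumr; apply: eq_bigr => k _.
  by rewrite rmorphM mulrA.
rewrite mulr_suml; apply: eq_bigr => j _.
by rewrite [conjv _ _ _]mxE conjcK -!mulrA [in RHS](mulrC (v 0 i)).
Qed.

Definition torsion_free (G : 'I_n -> 'I_n -> 'I_n -> R) : Prop :=
  forall i j k, G i j k = G j i k.

Definition metric_compatible (G : 'I_n -> 'I_n -> 'I_n -> R) x : Prop :=
  forall i j k, partial (fun y => g y j k) i x =
    \sum_l (G i j l * g x l k + G i k l * g x j l).

Variable x : 'rV[R]_n.
Hypothesis gU : g x \in unitmx.
Hypothesis gS : \forall y \near x, (g y)^T = g y.

Let gSx : (g x)^T = g x.
Proof. exact: nbhs_singleton gS. Qed.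

Let gsym i j : g x i j = g x j i.
Proof. by rewrite -{1}gSx mxE. Qed.

Let dgS i j k : partial (fun y => g y j k) i x = partial (fun y => g y k j) i x.
Proof.
apply: near_eq_derive; near=> y.
by rewrite -[in LHS](near gS y) ?mxE.
Unshelve. all: by end_near. Qed.

Let lower (G : 'I_n -> 'I_n -> 'I_n -> R) i j k : R := \sum_l G i j l * g x l k.

Let lower_christoffel i j k :
  lower (fun i j k => christoffel g i j k x) i j k =
  2^-1 * (partial (fun y => g y j k) i x + partial (fun y => g y i k) j x
          - partial (fun y => g y i j) k x).
Proof.
rewrite /lower /christoffel.
under eq_bigr => l _ do rewrite -mulrA mulr_suml.
rewrite -mulr_sumr; congr (_ * _); rewrite exchange_big /=.
under eq_bigr => m _.
  under eq_bigr => l _ do rewrite mulrAC gsym (mulrC (invmx _ _ _)).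
  rewrite -mulr_suml.
  have -> : \sum_l g x k l * invmx (g x) l m = (1%:M : 'M[R]_n) k m.
    by rewrite -(mulmxV gU) mxE.
  over.
rewrite (bigD1 k) //= big1 ?addr0 => [|m mk]; first by rewrite mxE eqxx mul1r.
by rewrite mxE eq_sym (negbTE mk) mul0r.
Qed.

Let sum_lower G i j k :
  \sum_l (G i j l * g x l k + G i k l * g x j l) = lower G i j k + lower G i k j.
Proof.
by rewrite big_split /=; congr (_ + _); apply: eq_bigr => l _; rewrite gsym.
Qed.

Lemma christoffel_torsion_free :
  torsion_free (fun i j k => christoffel g i j k x).
Proof.
move=> i j k; congr (_ * _); apply: eq_bigr => l _; congr (_ * _).
by rewrite (dgS l i j) (addrC (partial _ i x)).
Qed.

Lemma christoffel_metric_compatible :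
  metric_compatible (fun i j k => christoffel g i j k x) x.
Proof.
move=> i j k; rewrite (sum_lower (fun i j k => christoffel g i j k x)).
by rewrite !lower_christoffel (dgS i k j); field.
Qed.

Lemma levi_civita_unique (G : 'I_n -> 'I_n -> 'I_n -> R) :
  torsion_free G -> metric_compatible G x ->
  forall i j k, G i j k = christoffel g i j k x.
Proof.
move=> GT GM.
have low i j k : lower G i j k = lower (fun i j k => christoffel g i j k x) i j k.
  have LT a b c : lower G a b c = lower G b a c.
    by apply: eq_bigr => l _; rewrite GT.
  rewrite lower_christoffel !GM !sum_lower.
  by rewrite (LT j i) (LT k i) (LT k j); field.
have raise H i j k : H i j k = \sum_l lower H i j l * invmx (g x) l k.
  transitivity (((\row_l H i j l) *m (g x *m invmx (g x))) 0 k).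
    by rewrite mulmxV // mulmx1 mxE.
  rewrite mulmxA mxE; apply: eq_bigr => l _; rewrite mxE; congr (_ * _).
  by apply: eq_bigr => m _; rewrite mxE.
move=> i j k; rewrite raise [RHS](raise (fun i j k => christoffel g i j k x)).
by apply: eq_bigr => l _; rewrite low.
Qed.

End Justification.

(* Main.v *)
(** The identity is local, and in a chart it is an identity between polynomials
    in the iterated partial derivatives of g^-1, g, alpha and f.  It is proved
    once in a commutative ring A with commuting derivations d_i, a conjugation
    and an element I, and then specialized to the ring of complex functions
    smooth on the image of the chart, where Schwarz's theorem makes the partial
    derivatives commute.

    In A, let w = df + I f a, G = w g^-1 and H_i = nabla^a_i G, with lowered
    components H_ij.  Since nabla^a is metric, -Delta(|G|^2) is 2 |H|^2 plus
    twice the real part of <Q, G>, where Q = g^ij nabla^a_i H_j.  Torsion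
    freeness gives H_ij - H_ji = I f B_ij with B = da, and commuting covariant
    derivatives produces Ric and another B, so that
    Q_k = - (d^a Delta^a f)_k + Ric_km G^m + 2 I G^i B_ik - I f (delta B)_k. *)
Require Import Defs.
From HB Require Import structures.
From mathcomp Require Import all_boot all_order all_algebra.
From mathcomp Require Import complex ring.
From mathcomp Require Import all_classical all_reals all_analysis.

Set Implicit Arguments.
Unset Strict Implicit.
Unset Printing Implicit Defensive.

Import Order.TTheory GRing.Theory Num.Theory.
Import numFieldNormedType.Exports.

Local Open Scope ring_scope.

(** * Entrywise rules for matrices *)

Lemma addmxE (A : nmodType) m p (X Y : 'M[A]_(m, p)) k l :
  (X + Y) k l = X k l + Y k l.
Proof. exact: mxE. Qed.

Lemma scalemxE (A : pzRingType) m p u (X : 'M[A]_(m, p)) k l :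
  (u *: X) k l = u * X k l.
Proof. exact: mxE. Qed.

Lemma oppmxE (A : zmodType) m p (X : 'M[A]_(m, p)) k l : (- X) k l = - X k l.
Proof. exact: mxE. Qed.

Lemma trmxD (A : nmodType) m p (X Y : 'M[A]_(m, p)) : (X + Y)^T = X^T + Y^T.
Proof. exact: raddfD. Qed.

Lemma trmxN (A : zmodType) m p (X : 'M[A]_(m, p)) : (- X)^T = - X^T.
Proof. exact: raddfN. Qed.

Lemma map_mxE (A B : Type) (F : A -> B) m p (X : 'M[A]_(m, p)) k l :
  map_mx F X k l = F (X k l).
Proof. exact: mxE. Qed.

(** * The Bochner identity in a differential ring *)

Section AlgebraicBochner.
Variables (A : comPzRingType) (n : nat) (d : 'I_n -> {additive A -> A}).
Variables (cj : {rmorphism A -> A}) (I : A).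
Hypothesis dM : forall i u v, d i (u * v) = d i u * v + u * d i v.
Hypothesis dC : forall i j u, d i (d j u) = d j (d i u).
Hypothesis d_cj : forall i u, d i (cj u) = cj (d i u).
Hypothesis dI : forall i, d i I = 0.
Hypothesis cjK : involutive cj.
Hypothesis cjI : cj I = - I.
Hypothesis add_self_eq0 : forall u : A, u + u = 0 -> u = 0.

Variables (g gi : 'M[A]_n) (Gam : 'I_n -> 'M[A]_n) (a : 'rV[A]_n).
Hypothesis g_gi : g *m gi = 1%:M.
Hypothesis g_sym : g^T = g.
Hypothesis g_cj : map_mx cj g = g.
Hypothesis a_cj : map_mx cj a = a.
Hypothesis Gam_cj : forall i, map_mx cj (Gam i) = Gam i.
Hypothesis Gam_torsion : forall i j k, Gam i j k = Gam j i k.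
Hypothesis Gam_metric :
  forall i, map_mx (d i) g = Gam i *m g + g *m (Gam i)^T.

(* Algebraic counterparts, with prefix a, of the operators on an open set.
   Vector fields are rows and Gam i is the matrix (j, k) |-> Gamma_ij^k, so that
   acov i is the covariant derivative along the i-th frame field; acovA and the
   names ending in A are the magnetic versions, aR i k is the curvature
   operator (acting on rows), aB is d alpha, adelta is delta (d alpha), and acov2
   is the covariant derivative of a covariant 2-tensor. *)
Definition acov i (X : 'rV[A]_n) : 'rV[A]_n := map_mx (d i) X + X *m Gam i.
Definition acovA i (X : 'rV[A]_n) : 'rV[A]_n := acov i X + (I * a 0 i) *: X.
Definition adiv (X : 'rV[A]_n) : A := \sum_k acov k X 0 k.
Definition adivA (X : 'rV[A]_n) : A := adiv X + I * (X *m a^T) 0 0.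
Definition adiff (u : A) : 'rV[A]_n := \row_j d j u.
Definition adiffA (u : A) : 'rV[A]_n := adiff u + (I * u) *: a.
Definition alap (u : A) : A := - adiv (adiff u *m gi).
Definition agradA (u : A) : 'rV[A]_n := adiffA u *m gi.
Definition alapA (u : A) : A := - adivA (agradA u).
Definition ah (X Y : 'rV[A]_n) : A := (X *m g *m (map_mx cj Y)^T) 0 0.
Definition aR i k : 'M[A]_n := map_mx (d i) (Gam k) - map_mx (d k) (Gam i)
  + Gam k *m Gam i - Gam i *m Gam k.
Definition aric (v w : 'rV[A]_n) : A := \sum_i \sum_k v 0 k * (w *m aR i k) 0 i.
Definition aB : 'M[A]_n := \matrix_(i, j) (d i (a 0 j) - d j (a 0 i)).
Definition acov2 i (K : 'M[A]_n) : 'M[A]_n :=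
  map_mx (d i) K - Gam i *m K - K *m (Gam i)^T.
Definition adelta : 'rV[A]_n := \row_k - \sum_i (gi *m acov2 i aB) i k.

(** * Inverse metric and metric compatibility *)

Lemma gi_g : gi *m g = 1%:M. Proof. exact: mulmx1C. Qed.

Lemma gi_sym : gi^T = gi.
Proof.
by rewrite -[LHS]mulmx1 -g_gi mulmxA -{1}g_sym -trmx_mul g_gi trmx1 mul1mx.
Qed.

Lemma gi_cj : map_mx cj gi = gi.
Proof.
rewrite -[LHS]mul1mx -gi_g -mulmxA -{1}g_cj -map_mxM g_gi.
by rewrite map_mx1 mulmx1.
Qed.

Lemma d1 i : d i 1 = 0.
Proof.
have := dM i 1 1; rewrite !mulr1 mul1r => /eqP.
by rewrite -subr_eq subrr => /eqP <-.
Qed.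

Lemma d_mulmx i m p q (X : 'M[A]_(m, p)) (Y : 'M[A]_(p, q)) :
  map_mx (d i) (X *m Y) = map_mx (d i) X *m Y + X *m map_mx (d i) Y.
Proof.
apply/matrixP => k l; rewrite !mxE raddf_sum -big_split /=.
by apply: eq_bigr => s _; rewrite dM !mxE.
Qed.

Lemma d_scalemx i u m p (X : 'M[A]_(m, p)) :
  map_mx (d i) (u *: X) = d i u *: X + u *: map_mx (d i) X.
Proof. by apply/matrixP => k l; rewrite !mxE dM. Qed.

Lemma d_scalar_mx1 i : map_mx (d i) (1%:M : 'M[A]_n) = 0.
Proof.
by apply/matrixP => k l; rewrite !mxE; case: eqP; rewrite ?d1 ?raddf0.
Qed.

(** The inverse metric is parallel too: differentiate [gi *m g = 1%:M] and insert [Gam_metric]. *)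
Lemma d_gi i : map_mx (d i) gi = - (gi *m Gam i) - (Gam i)^T *m gi.
Proof.
have /eqP := congr1 (map_mx (d i)) gi_g.
rewrite d_mulmx d_scalar_mx1 addr_eq0 => /eqP /(congr1 (mulmx^~ gi)).
rewrite -mulmxA g_gi mulmx1 => ->.
rewrite Gam_metric mulNmx mulmxDr mulmxDl opprD.
by rewrite (mulmxA gi g) gi_g mul1mx -!mulmxA g_gi mulmx1.
Qed.

(** The magnetic connection is Hermitian: as [a] is real and [cj I = - I], the potential terms of
    the two slots cancel, and metric compatibility does the rest. *)
Lemma d_ah i X Y : d i (ah X Y) = ah (acovA i X) Y + ah X (acovA i Y).
Proof.
have -> : d i (ah X Y) = (map_mx (d i) (X *m g *m (map_mx cj Y)^T)) 0 0.
  by rewrite [RHS]mxE.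
have dY : map_mx (d i) (map_mx cj Y)^T = (map_mx cj (map_mx (d i) Y))^T.
  by apply/matrixP => k l; rewrite !mxE d_cj.
rewrite !d_mulmx Gam_metric dY /ah /acovA /acov.
rewrite !map_mxD map_mxM Gam_cj map_mxZ rmorphM cjI /=.
have -> : cj (a 0 i) = a 0 i by rewrite -{2}a_cj mxE.
rewrite !linearD /= !linearZ /= trmx_mul !mulmxDl -!scalemxAl !mulmxA.
rewrite !(addmxE, scalemxE).
by ring.
Qed.

(** Raising an index commutes with covariant differentiation: after [d_gi] one connection term
    cancels, and the other is the one for covectors. *)
Lemma adivE (w : 'rV[A]_n) :
  adiv (w *m gi) = \sum_k \sum_j (d k (w 0 j) - (w *m (Gam k)^T) 0 j) * gi j k.
Proof.
apply: eq_bigr => k _; rewrite /acov d_mulmx d_gi mulmxBr mulmxN !mulmxA.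
rewrite addrA addrAC subrK -mulmxBl mxE.
by apply: eq_bigr => j _; rewrite !mxE.
Qed.


(** * Symmetries of the curvature *)

Lemma gam_mul i k m l : (Gam k *m Gam i) m l = (Gam m *m Gam i) k l.
Proof.
by rewrite !mxE; apply: eq_bigr => s _; rewrite Gam_torsion.
Qed.

Lemma aR_anti i k : aR k i = - aR i k.
Proof. by apply/matrixP => m l; rewrite !mxE; ring. Qed.

(** First Bianchi identity. Torsion freeness pairs off the derivatives of [Gam] and, through
    [gam_mul], the quadratic terms. *)
Lemma aR_bianchi i k m l : aR i k m l + aR k m i l + aR m i k l = 0.
Proof.
rewrite !(addmxE, oppmxE) !map_mxE (Gam_torsion k m) (Gam_torsion i m).
rewrite (Gam_torsion i k) (gam_mul i k) (gam_mul k i) (gam_mul m k).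
by ring.
Qed.

(** The second derivatives of [g] commute. Expanded by metric compatibility, their difference loses
    its mixed terms and becomes the curvature acting on both slots of [g]. *)
Lemma aR_skew i k : aR i k *m g + g *m (aR i k)^T = 0.
Proof.
have dd : map_mx (d i) (map_mx (d k) g) = map_mx (d k) (map_mx (d i) g).
  by apply/matrixP => p q; rewrite !mxE dC.
have dT j p : map_mx (d j) (Gam p)^T = (map_mx (d j) (Gam p))^T.
  by apply/matrixP => q r; rewrite !mxE.
(* The zero on the right is replaced by the difference of the second derivatives of [g]. *)
move/eqP: dd; rewrite -subr_eq0 => /eqP <-.
rewrite !Gam_metric !map_mxD !d_mulmx !Gam_metric !dT /aR.
rewrite !trmxD !trmxN !trmx_mul !(mulmxDr, mulmxDl, mulNmx, mulmxN) !mulmxA.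
apply/matrixP => p q; rewrite !(addmxE, oppmxE).
by ring.
Qed.

(** Skewness multiplied by [gi] on the right has a trace that is twice the one wanted;
    [add_self_eq0] replaces division by 2. *)
Lemma aR_trace i k : \tr (aR i k) = 0.
Proof.
apply: add_self_eq0.
have /(congr1 (mulmx^~ gi)) := aR_skew i k.
rewrite mulmxDl mul0mx -mulmxA g_gi mulmx1 => /(congr1 mxtrace).
by rewrite raddfD /= mxtrace0 mxtrace_mulC mulmxA gi_g mul1mx mxtrace_tr.
Qed.

(* Tracing the Bianchi identity leaves the trace of aR k m, which vanishes
   because aR k m is skew for g. *)
Lemma aric_sym v w : aric v w = aric w v.
Proof.
have E v' w' : aric v' w' =
    \sum_k \sum_m v' 0 k * w' 0 m * \sum_i aR i k m i.
  rewrite /aric exchange_big; apply: eq_bigr => k _ /=.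
  under eq_bigr => i _ do rewrite mxE mulr_sumr.
  rewrite exchange_big; apply: eq_bigr => m _ /=.
  by rewrite mulr_sumr; apply: eq_bigr => i _; rewrite mulrA.
rewrite !E exchange_big; apply: eq_bigr => m _; apply: eq_bigr => k _ /=.
rewrite [v 0 k * _]mulrC; congr (_ * _); apply/eqP; rewrite -subr_eq0 -sumrB.
have := aR_trace k m; rewrite /mxtrace => /eqP; rewrite -oppr_eq0 -sumrN.
congr (_ == _); apply: eq_bigr => i _.
have := aR_bianchi i k m i; rewrite (aR_anti i m) oppmxE.
by move/eqP; rewrite addrAC addr_eq0 => /eqP.
Qed.

(** * Pairings and the magnetic curvature *)

Definition adot (u v : 'rV[A]_n) : A := (u *m v^T) 0 0.

Lemma adotE u v : adot u v = \sum_k u 0 k * v 0 k.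
Proof. by rewrite /adot mxE; apply: eq_bigr => k _; rewrite mxE. Qed.

Lemma ah_cj X Y : cj (ah X Y) = ah Y X.
Proof.
have -> : cj (ah X Y) = (map_mx cj (X *m g *m (map_mx cj Y)^T)) 0 0.
  by rewrite [RHS]mxE.
have cYT : map_mx cj (map_mx cj Y)^T = Y^T.
  by apply/matrixP => k l; rewrite !mxE cjK.
rewrite !map_mxM g_cj cYT /ah -[in RHS](trmxK (Y *m g *m _)) [in RHS]mxE.
by rewrite !trmx_mul trmxK g_sym mulmxA.
Qed.

(** Curvature of the magnetic connection: the Levi-Civita part plus the field [I * aB i k]. The
    frame fields commute, and [i], [k] are mere labels here, so neither a bracket nor a correction
    for these indices occurs. *)
Lemma acovA_comm i k X : acovA i (acovA k X) - acovA k (acovA i X) =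
  X *m aR i k + (I * aB i k) *: X.
Proof.
have dd : map_mx (d i) (map_mx (d k) X) = map_mx (d k) (map_mx (d i) X).
  by apply/matrixP => p q; rewrite !mxE dC.
rewrite /acovA /acov !map_mxD !d_scalemx !d_mulmx !dM !dI dd /aR.
rewrite !mulmxDr !mulmxN !mulmxDl -!scalemxAl !mulmxA.
apply/matrixP => p q; rewrite !(addmxE, oppmxE, scalemxE) [aB i k]mxE.
by ring.
Qed.

Lemma ah_sharp X u : ah X (u *m gi) = adot X (map_mx cj u).
Proof.
by rewrite /ah /adot map_mxM gi_cj trmx_mul gi_sym mulmxA -(mulmxA X) g_gi mulmx1.
Qed.

(** * Coordinate-free operators and their components *)

Definition aderiv (X : 'rV[A]_n) (u : A) : A := \sum_i X 0 i * d i u.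
Definition anabla (Y X : 'rV[A]_n) : 'rV[A]_n := \sum_i Y 0 i *: acov i X.
Definition alie (X Y : 'rV[A]_n) : 'rV[A]_n :=
  \row_k (aderiv X (Y 0 k) - aderiv Y (X 0 k)).
Definition aext (X Y : 'rV[A]_n) : A :=
  aderiv X (adot a Y) - aderiv Y (adot a X) - adot a (alie X Y).
Definition acurv (X Y Z : 'rV[A]_n) : 'rV[A]_n :=
  anabla X (anabla Y Z) - anabla Y (anabla X Z) - anabla (alie X Y) Z.
Definition anabla_ext (Z X Y : 'rV[A]_n) : A :=
  aderiv Z (aext X Y) - aext (anabla Z X) Y - aext X (anabla Z Y).

Lemma aderiv_adot X Y : aderiv X (adot a Y) =
  \sum_i \sum_k X 0 i * d i (a 0 k) * Y 0 k + adot a (\row_k aderiv X (Y 0 k)).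
Proof.
rewrite !adotE [X in _ + X](eq_bigr (fun k => \sum_i a 0 k * (X 0 i * d i (Y 0 k)))).
  rewrite [X in _ + X]exchange_big -big_split; apply: eq_bigr => i _ /=.
  rewrite raddf_sum mulr_sumr -big_split; apply: eq_bigr => k _ /=.
  by rewrite dM; ring.
by move=> k _; rewrite mxE mulr_sumr.
Qed.

(** By [aderiv_adot] the derivatives of [X] and [Y] are exactly what the bracket term removes, so
    only derivatives of [a] remain. *)
Lemma aextE X Y : aext X Y = adot (X *m aB) Y.
Proof.
rewrite /aext !aderiv_adot.
have -> : adot a (alie X Y) = adot a (\row_k aderiv X (Y 0 k))
    - adot a (\row_k aderiv Y (X 0 k)).
  by rewrite !adotE -sumrB; apply: eq_bigr => k _; rewrite !mxE mulrBr.
set S := \sum_i _; set S' := \sum_i _; rewrite opprB.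
transitivity (S - S'); first by ring.
rewrite [S']exchange_big -sumrB.
rewrite adotE; under [RHS]eq_bigr do rewrite mxE mulr_suml.
rewrite [RHS]exchange_big; apply: eq_bigr => i _ /=; rewrite -sumrB.
by apply: eq_bigr => k _; rewrite mxE; ring.
Qed.

(** Models the vector fields with constant components, by which [ricci] and [codiff_ext_d] extend
    vectors given at a point. *)
Definition dclosed (W : 'rV[A]_n) := forall i, map_mx (d i) W = 0.

Lemma d_dclosed W i k : dclosed W -> d i (W 0 k) = 0.
Proof. by move=> W_cst; rewrite -map_mxE W_cst mxE. Qed.

Lemma anabla_dclosed V W : dclosed W ->
  anabla V W = \sum_i V 0 i *: (W *m Gam i).
Proof. by move=> W_cst; apply: eq_bigr => i _; rewrite /acov W_cst add0r. Qed.

Lemma acov_anabla_dclosed V W i : dclosed V -> dclosed W ->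
  acov i (anabla V W) =
  \sum_j V 0 j *: (W *m map_mx (d i) (Gam j) + W *m Gam j *m Gam i).
Proof.
move=> V_cst W_cst.
rewrite anabla_dclosed // /acov raddf_sum mulmx_suml -big_split.
apply: eq_bigr => j _ /=.
rewrite d_scalemx d_dclosed // scale0r add0r d_mulmx W_cst mul0mx add0r.
by rewrite -scalemxAl scalerDr.
Qed.

Section Constant.
Variables X Y Z : 'rV[A]_n.
Hypotheses (X_cst : dclosed X) (Y_cst : dclosed Y) (Z_cst : dclosed Z).

Lemma alie_cst : alie X Y = 0.
Proof.
apply/rowP => k; rewrite !mxE /aderiv !big1 ?subr0 // => i _;
  by rewrite d_dclosed // mulr0.
Qed.

(** With constant components the bracket vanishes, and what survives are derivatives of [Gam] and
    products of two of them: the terms of [aR]. *)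
Lemma acurvE : acurv X Y Z = \sum_i \sum_j (X 0 i * Y 0 j) *: (Z *m aR i j).
Proof.
rewrite /acurv alie_cst.
have -> : anabla 0 Z = 0 by rewrite /anabla big1 // => i _; rewrite mxE scale0r.
rewrite subr0 {1 3}/anabla.
under eq_bigr => i _ do rewrite acov_anabla_dclosed // scaler_sumr.
under [X in _ - X]eq_bigr => i _ do rewrite acov_anabla_dclosed // scaler_sumr.
rewrite [X in _ - X]exchange_big /= -sumrB; apply: eq_bigr => i _.
rewrite -sumrB; apply: eq_bigr => j _.
rewrite !scalerA [Y 0 j * _]mulrC -scalerBr; congr (_ *: _).
rewrite /aR !mulmxDr !mulmxN -!mulmxA.
by apply/rowP => k; rewrite !(addmxE, oppmxE); ring.
Qed.

(** The corrections for the derivatives of the constant fields [X] and [Y] are the two [Gam] terms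
    of [acov2]. *)
Lemma anabla_extE :
  anabla_ext Z X Y = \sum_i Z 0 i * adot (X *m acov2 i aB) Y.
Proof.
rewrite /anabla_ext !aextE !anabla_dclosed //.
have -> : adot ((\sum_i Z 0 i *: (X *m Gam i)) *m aB) Y =
    \sum_i Z 0 i * adot (X *m Gam i *m aB) Y.
  rewrite /adot !mulmx_suml summxE; apply: eq_bigr => i _.
  by rewrite -!scalemxAl scalemxE.
have -> : adot (X *m aB) (\sum_i Z 0 i *: (Y *m Gam i)) =
    \sum_i Z 0 i * adot (X *m aB *m (Gam i)^T) Y.
  rewrite /adot raddf_sum mulmx_sumr summxE; apply: eq_bigr => i _.
  by rewrite /= linearZ /= -scalemxAr scalemxE trmx_mul mulmxA.
rewrite -!sumrB; apply: eq_bigr => i _.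
have -> : d i (adot (X *m aB) Y) = adot (X *m map_mx (d i) aB) Y.
  rewrite /adot -(map_mxE (d i)) !d_mulmx X_cst mul0mx add0r.
  have -> : map_mx (d i) Y^T = 0 by rewrite -map_trmx Y_cst trmx0.
  by rewrite mulmx0 addr0.
rewrite /adot /acov2 !(mulmxDr, mulmxN, mulmxDl, mulNmx) !mulmxA.
by rewrite !(addmxE, oppmxE); ring.
Qed.

End Constant.

(** * Reality of the magnetic field, and linear combinations of derivatives *)

Lemma map_cjK p q (X : 'M[A]_(p, q)) : map_mx cj (map_mx cj X) = X.
Proof. by apply/matrixP => i j; rewrite !mxE cjK. Qed.

Lemma d_map_cj p q i (X : 'M[A]_(p, q)) :
  map_mx cj (map_mx (d i) X) = map_mx (d i) (map_mx cj X).
Proof. by apply/matrixP => k l; rewrite !mxE d_cj. Qed.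

Lemma aB_cj : map_mx cj aB = aB.
Proof.
by apply/matrixP => i j; rewrite !mxE rmorphB /= -!d_cj -!(map_mxE cj) a_cj.
Qed.

Lemma acov2_cj i : map_mx cj (acov2 i aB) = acov2 i aB.
Proof.
rewrite /acov2 !(map_mxD, map_mxN, map_mxM) d_map_cj aB_cj Gam_cj -map_trmx.
by rewrite Gam_cj.
Qed.

Lemma adelta_cj : map_mx cj adelta = adelta.
Proof.
apply/rowP => k; rewrite !mxE rmorphN rmorph_sum; congr (- _).
by apply: eq_bigr => i _; rewrite /= -!(map_mxE cj) map_mxM gi_cj acov2_cj.
Qed.

Lemma adotC u v : adot u v = adot v u.
Proof. by rewrite !adotE; apply: eq_bigr => k _; exact: mulrC. Qed.

Lemma adotZ c u v : adot (c *: u) v = c * adot u v.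
Proof. by rewrite /adot -scalemxAl scalemxE. Qed.

Lemma anablaA X Y :
  anabla Y X + (I * adot a Y) *: X = \sum_i Y 0 i *: acovA i X.
Proof.
rewrite adotE mulr_sumr scaler_suml -big_split; apply: eq_bigr => i _ /=.
rewrite /acovA; move: (acov i X) => V; apply/rowP => k.
by rewrite !(addmxE, scalemxE); ring.
Qed.

(** Serves to expand the Hessian norm, with [u] and [v] both equal to a vector of an orthonormal
    basis. *)
Lemma ah_sum (u v : 'rV[A]_n) (F : 'I_n -> 'rV[A]_n) :
  ah (\sum_i u 0 i *: F i) (\sum_i v 0 i *: F i) =
  \sum_i \sum_j u 0 i * cj (v 0 j) * ah (F i) (F j).
Proof.
have -> : ah (\sum_i u 0 i *: F i) (\sum_i v 0 i *: F i) =
    \sum_i u 0 i * ah (F i) (\sum_j v 0 j *: F j).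
  rewrite /ah !mulmx_suml summxE.
  by apply: eq_bigr => i _; rewrite -!scalemxAl scalemxE.
apply: eq_bigr => i _.
have -> : ah (F i) (\sum_j v 0 j *: F j) = \sum_j cj (v 0 j) * ah (F i) (F j).
  rewrite /ah (raddf_sum (map_mx cj)) raddf_sum mulmx_sumr summxE.
  apply: eq_bigr => j _.
  by rewrite /= map_mxZ linearZ /= -scalemxAr scalemxE.
by rewrite mulr_sumr; apply: eq_bigr => j _; rewrite mulrA.
Qed.

(** * The magnetic Hessian and its covariant derivative *)

Section Function.
Variable f : A.
Let G := agradA f.
Let Hess : 'M[A]_n := \matrix_k acovA k G.
Let Klow := Hess *m g.

Lemma agradA_lower : G *m g = adiffA f.
Proof. by rewrite /G /agradA -mulmxA gi_g mulmx1. Qed.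

(** By metric compatibility the index may be lowered before differentiating; this gives the magnetic
    covariant derivative of the 1-form [adiffA f], which involves no inverse metric. *)
Lemma lowered_HessE i k : Klow i k = d i (adiffA f 0 k) - (adiffA f *m (Gam i)^T) 0 k
   + I * a 0 i * adiffA f 0 k.
Proof.
transitivity ((acovA i G *m g) 0 k).
  by rewrite !mxE; apply: eq_bigr => j _; rewrite !mxE.
move: (adiffA f) agradA_lower => w Gw.
have := congr1 (map_mx (d i)) Gw; rewrite d_mulmx Gam_metric mulmxDr !mulmxA.
rewrite /acovA /acov !mulmxDl -scalemxAl Gw.
move=> /(congr1 (fun X : 'rV_n => X 0 k)).
rewrite !(addmxE, scalemxE) map_mxE => <-.
by ring.
Qed.

(** Second derivatives of [f], the [Gam] terms, and the products of [a] with first derivatives of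
    [f] are symmetric in total; the antisymmetric part comes from the derivatives of [a] alone. *)
Lemma lowered_Hess_skew : Klow = Klow^T + (I * f) *: aB.
Proof.
apply/matrixP => i k; rewrite addmxE scalemxE [Klow^T _ _]mxE !lowered_HessE.
have -> : (adiffA f *m (Gam k)^T) 0 i = (adiffA f *m (Gam i)^T) 0 k.
  by rewrite !mxE; apply: eq_bigr => l _; rewrite !mxE Gam_torsion.
rewrite !(mxE, addmxE, scalemxE) !raddfD /= !dM !dI (dC k i).
by ring.
Qed.


(** The second magnetic covariant derivative of [G]: [Hess] is differentiated as a tensor with a
    covariant row index and a contravariant column index. *)
Let D2G i : 'M[A]_n :=
  map_mx (d i) Hess + Hess *m Gam i - Gam i *m Hess + (I * a 0 i) *: Hess.

Lemma D2G_lower i : D2G i *m g = acov2 i Klow + (I * a 0 i) *: Klow.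
Proof.
rewrite /D2G /acov2 /Klow d_mulmx Gam_metric !mulmxDl mulmxDr mulNmx -scalemxAl.
rewrite !mulmxA; apply/matrixP => p q; rewrite !(addmxE, oppmxE, scalemxE).
by ring.
Qed.

Lemma row_D2G i k :
  row k (D2G i) = acovA i (acovA k G) - \sum_l Gam i k l *: acovA l G.
Proof.
apply/rowP => m; rewrite /acovA /acov -/(acovA k G).
rewrite /D2G !mxE summxE.
rewrite addrAC; congr (_ + _ + _ - _).
- by apply: eq_bigr => s _; rewrite !mxE.
- by apply: eq_bigr => s _; rewrite !mxE.
Qed.

(** Ricci identity: the corrections in [row_D2G] agree for both orders by torsion freeness, so
    [acovA_comm] carries over. *)
Lemma D2G_swap i k m :
  D2G i k m = D2G k i m + (G *m aR i k) 0 m + I * aB i k * G 0 m.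
Proof.
have := acovA_comm i k G => /(congr1 (fun X : 'rV_n => X 0 m)).
have <- : row k (D2G i) 0 m = D2G i k m by rewrite mxE.
have <- : row i (D2G k) 0 m = D2G k i m by rewrite mxE.
rewrite !row_D2G !(addmxE, oppmxE, scalemxE).
have -> : \sum_l Gam k i l *: acovA l G = \sum_l Gam i k l *: acovA l G.
  by apply: eq_bigr => l _; rewrite Gam_torsion.
by move/eqP; rewrite subr_eq => /eqP ->; ring.
Qed.

Lemma trace_Hess : \tr Hess = - alapA f.
Proof.
rewrite /alapA opprK /adivA /adiv [(_ *m _) 0 0]mxE mulr_sumr -big_split /=.
apply: eq_bigr => k _; rewrite !mxE.
by congr (_ + _); ring.
Qed.

(** The two [Gam] terms have the same trace by cyclicity, so the trace commutes with the magnetic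
    derivative. *)
Lemma trace_D2G m : \tr (D2G m) = - adiffA (alapA f) 0 m.
Proof.
have trd : \tr (map_mx (d m) Hess) = d m (\tr Hess).
  by rewrite /mxtrace raddf_sum; apply: eq_bigr => k _; rewrite [LHS]mxE.
rewrite /D2G !raddfD raddfN /= mxtraceZ trd mxtrace_mulC addrK trace_Hess.
by rewrite !mxE raddfN; ring.
Qed.

(** The field Q of the overview, as a vector: the trace of [D2G] over its two differentiation
    indices. *)
Let rough_lap := \sum_i row i (gi *m D2G i).

Lemma acov2_tr i X : acov2 i X^T = (acov2 i X)^T.
Proof.
rewrite /acov2 !trmxD !trmxN !trmx_mul trmxK addrAC; congr (_ - _ - _).
by apply/matrixP => p q; rewrite !mxE.
Qed.

(** Two exchanges of indices turn the trace over both derivatives into the derivative of [\tr Hess]: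
    first the two indices of the lowered Hessian ([Ksym]), then the two derivatives ([D2G_swap]).
    Each contributes one [I * (G *m aB) 0 m], whence the factor 2. *)
Lemma rough_lap_lower m : (rough_lap *m g) 0 m = - adiffA (alapA f) 0 m
  + \sum_i (G *m aR i m) 0 i + 2 * I * (G *m aB) 0 m - I * f * adelta 0 m.
Proof.
(* This is the derivative of [lowered_Hess_skew]: the potential term completes the derivative of [f]
   to [adiffA f], and [aB] contributes [acov2 i aB]. *)
have Ksym i : D2G i *m g = (D2G i *m g)^T + (I * adiffA f 0 i) *: aB
    + (I * f) *: acov2 i aB.
  rewrite D2G_lower linearD /= linearZ /= -acov2_tr [in LHS]lowered_Hess_skew.
  rewrite /acov2 map_mxD d_scalemx dM dI !(mulmxDr, mulmxDl) -!scalemxAr -!scalemxAl.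
  apply/matrixP => p q; rewrite !(addmxE, oppmxE, scalemxE).
  by rewrite [adiff _ _ _]mxE; ring.
have -> : (rough_lap *m g) 0 m = \sum_i (gi *m (D2G i *m g)) i m.
  rewrite /rough_lap mulmx_suml summxE; apply: eq_bigr => i _.
  by rewrite -row_mul -mulmxA [LHS]mxE.
have E i : (gi *m (D2G i *m g)) i m =
    D2G m i i + (G *m aR i m) 0 i + I * aB i m * G 0 i
    + I * (adiffA f 0 i * (gi *m aB) i m) + I * f * (gi *m acov2 i aB) i m.
  (* After the first exchange, [gi] raises the index that was lowered by [g], so that [D2G_swap]
     applies. *)
  have T : gi *m (D2G i *m g)^T = (D2G i)^T.
    by rewrite trmx_mul g_sym mulmxA gi_g mul1mx.
  rewrite -D2G_swap Ksym; move: (acov2 i aB) (adiffA f 0 i) => C w.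
  rewrite !mulmxDr -!scalemxAr T; move: (D2G i) => Ei.
  by rewrite !(addmxE, scalemxE) [_^T _ _]mxE mulrA.
rewrite (eq_bigr _ (fun i _ => E i)).
rewrite !big_split /= -!mulr_sumr.
have -> : \sum_i D2G m i i = - adiffA (alapA f) 0 m by rewrite -trace_D2G.
have -> : \sum_i adiffA f 0 i * (gi *m aB) i m = (G *m aB) 0 m.
  by rewrite /G /agradA -mulmxA [RHS]mxE.
have -> : \sum_i I * aB i m * G 0 i = I * (G *m aB) 0 m.
  by rewrite [(G *m aB) 0 m]mxE mulr_sumr; apply: eq_bigr => i _; ring.
have -> : \sum_i (gi *m acov2 i aB) i m = - adelta 0 m.
  by rewrite [adelta _ _]mxE opprK.
by ring.
Qed.

Lemma ah_rough_lap : ah rough_lap G = - ah (agradA (alapA f)) G + aric (map_mx cj G) G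
  + 2 * I * adot (G *m aB) (map_mx cj G) - I * f * adot adelta (map_mx cj G).
Proof.
have ahE X Y : ah X Y = \sum_m (X *m g) 0 m * map_mx cj Y 0 m.
  by rewrite /ah mxE; apply: eq_bigr => m _; rewrite [X in _ * X = _]mxE.
rewrite !ahE !adotE /aric exchange_big /= !mulr_sumr -!sumrN -!big_split /=.
apply: eq_bigr => m _; rewrite rough_lap_lower.
rewrite -mulr_sumr /agradA -mulmxA gi_g mulmx1.
by ring.
Qed.

(** Twice the identity sought, because 2 is not assumed to be invertible in [A]. *)
Theorem magnetic_bochner_algebra :
  - alap (ah G G) =
    2 * (\sum_i \sum_j gi i j * ah (acovA i G) (acovA j G))
    - (ah G (agradA (alapA f)) + ah (agradA (alapA f)) G)
    + 2 * aric G (map_mx cj G)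
    + 2 * I * (adot (G *m aB) (map_mx cj G) - adot (map_mx cj G *m aB) G)
    + I * (cj f * adot adelta G - f * adot adelta (map_mx cj G)).
Proof.
(* Second covariant derivative of the squared norm: [d_ah] is applied twice, and the [Gam]
   correction turns the iterated derivatives of [G] into rows of [D2G]. *)
have dh k j : d k (adiff (ah G G) 0 j) - (adiff (ah G G) *m (Gam k)^T) 0 j =
    ah (row j (D2G k)) G + ah G (row j (D2G k))
    + (ah (acovA j G) (acovA k G) + ah (acovA k G) (acovA j G)).
  have ahBl X Y Z : ah (X - Y) Z = ah X Z - ah Y Z.
    by rewrite /ah !mulmxBl addmxE oppmxE.
  have ahBr X Y Z : ah Z (X - Y) = ah Z X - ah Z Y.
    by rewrite -!(ah_cj _ Z) ahBl rmorphB.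
  have ahSl (F : 'I_n -> A) (X : 'I_n -> 'rV[A]_n) Z :
      ah (\sum_l F l *: X l) Z = \sum_l F l * ah (X l) Z.
    rewrite /ah !mulmx_suml summxE.
    by apply: eq_bigr => l _; rewrite -!scalemxAl scalemxE.
  have ahSr X Z : ah Z (\sum_l Gam k j l *: X l) = \sum_l Gam k j l * ah Z (X l).
    rewrite -ah_cj ahSl rmorph_sum; apply: eq_bigr => l _ /=.
    by rewrite rmorphM /= ah_cj -{1}(Gam_cj k) map_mxE cjK.
  rewrite row_D2G ahBl ahBr ahSl ahSr /adiff [X in d k X]mxE !d_ah raddfD /= !d_ah.
  have -> : (\row_l d l (ah G G) *m (Gam k)^T) 0 j =
      \sum_l Gam k j l * ah (acovA l G) G + \sum_l Gam k j l * ah G (acovA l G).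
    rewrite mxE -big_split /=; apply: eq_bigr => l _.
    by rewrite !mxE d_ah; ring.
  by ring.
rewrite /alap opprK adivE.
under eq_bigr => k _ do under eq_bigr => j _ do rewrite dh mulrDl mulrDl.
have dist (F1 F2 F3 : 'I_n -> 'I_n -> A) :
    \sum_i \sum_j (F1 i j + F2 i j + F3 i j) =
    \sum_i \sum_j F1 i j + \sum_i \sum_j F2 i j + \sum_i \sum_j F3 i j.
  by rewrite -!big_split; apply: eq_bigr => i _; rewrite -!big_split.
rewrite dist.
have giS i j : gi j i = gi i j by rewrite -{1}gi_sym mxE.
have QE : \sum_i \sum_j ah (row j (D2G i)) G * gi j i = ah rough_lap G.
  rewrite /ah /rough_lap !mulmx_suml summxE; apply: eq_bigr => i _ /=.
  rewrite row_mul (mulmx_sum_row (row i gi)) !mulmx_suml summxE.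
  by apply: eq_bigr => j _; rewrite -!scalemxAl scalemxE [row i gi _ _]mxE giS mulrC.
have QcE : \sum_i \sum_j ah G (row j (D2G i)) * gi j i = cj (ah rough_lap G).
  rewrite -QE rmorph_sum; apply: eq_bigr => i _; rewrite rmorph_sum.
  by apply: eq_bigr => j _; rewrite rmorphM /= ah_cj -{1}gi_cj map_mxE.
(* The symmetry of [gi] makes the two products of first derivatives contribute equally. *)
have HE : \sum_i \sum_j (ah (acovA j G) (acovA i G) + ah (acovA i G) (acovA j G))
    * gi j i = 2 * \sum_i \sum_j gi i j * ah (acovA i G) (acovA j G).
  under eq_bigr => i _ do under eq_bigr => j _ do rewrite mulrDl.
  under eq_bigr => i _ do rewrite big_split.
  rewrite big_split /= exchange_big /= mulr_natl mulr2n.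
  by congr (_ + _); apply: eq_bigr => i _; apply: eq_bigr => j _;
    rewrite mulrC // giS.
rewrite QE QcE HE ah_rough_lap.
have cjdot u v : cj (adot u v) = adot (map_mx cj u) (map_mx cj v).
  by rewrite !adotE rmorph_sum; apply: eq_bigr => i _; rewrite !mxE rmorphM.
have Rcj i k : map_mx cj (aR i k) = aR i k.
  by rewrite /aR !(map_mxD, map_mxN, map_mxM) !d_map_cj !Gam_cj.
(* Conjugation exchanges the two arguments of [aric]; by [aric_sym] both curvature terms then add
   up. *)
have ccj : cj (aric (map_mx cj G) G) = aric G (map_mx cj G).
  rewrite /aric rmorph_sum; apply: eq_bigr => i _; rewrite rmorph_sum.
  apply: eq_bigr => k _; rewrite rmorphM /= -!(map_mxE cj).
  by rewrite map_mxM Rcj map_cjK.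
rewrite !(rmorph_nat, rmorphD, rmorphB, rmorphN, rmorphM) /= ccj cjI ah_cj !cjdot.
rewrite (map_mxM _ G) adelta_cj aB_cj map_cjK (aric_sym (map_mx cj G) G).
by ring.
Qed.

End Function.
End AlgebraicBochner.

Local Open Scope classical_set_scope.
Local Open Scope ring_scope.

(** * Smooth functions on an open set *)

Section Smooth.
Variables (R : realType) (n : nat) (U : set 'rV[R]_n).
Hypothesis oU : open U.
Implicit Types u v : 'rV[R]_n -> R.

Lemma near_open x : U x -> \forall y \near x, U y.
Proof. by move=> Ux; apply: open_nbhs_nbhs. Qed.

(** Limits and derivatives at a point of the open set [U] depend only on values in [U]. *)
Lemma Ck_ext k u v : (forall y, U y -> u y = v y) -> Ck k U u -> Ck k U v.
Proof.
move=> uv cku.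
have nuv (w w' : 'rV[R]_n -> R) (ww' : forall y, U y -> w y = w' y) x :
  U x -> \forall y \near x, w y = w' y by move=> /near_open; apply: filterS.
have cv (w w' : 'rV[R]_n -> R) (ww' : forall y, U y -> w y = w' y) x :
    U x -> {for x, continuous w} -> {for x, continuous w'}.
  move=> Ux cw; rewrite /prop_for /continuous_at -(ww' _ Ux).
  apply: cvg_trans cw; exact: (near_eq_cvg (nuv _ _ ww' _ Ux)).
elim: k u v uv cku => [|k IH] u v uv [cu hu].
  by split=> // x Ux; exact: cv uv _ Ux (cu _ Ux).
split=> [x Ux|i]; first exact: cv uv _ Ux (cu _ Ux).
have [du ck] := hu i; split=> [x Ux|].
  exact: near_eq_derivable (nuv _ _ uv _ Ux) (du _ Ux).
by apply: IH ck => y Uy; apply: near_eq_derive; exact: nuv uv _ Uy.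
Qed.

(** Needed for the Leibniz rule, where undifferentiated factors stand beside derivatives of one
    class less. *)
Lemma Ck_pred k u : Ck k.+1 U u -> Ck k U u.
Proof.
elim: k u => [|k IH] u [cu hu]; split=> // i.
by have [du ck] := hu i; split=> //; exact: IH.
Qed.

Lemma Ck_cst k (c : R) : Ck k U (cst c).
Proof.
elim: k c => [|k IH] c; first by split=> // x _; exact: cst_continuous.
split=> [x _|i]; first exact: cst_continuous.
split=> [x _|]; first exact: derivable_cst.
by apply: Ck_ext (IH 0) => y _; rewrite /partial derive_cst.
Qed.

Lemma CkD k u v : Ck k U u -> Ck k U v -> Ck k U (fun x => u x + v x).
Proof.
elim: k u v => [|k IH] u v [cu hu] [cv hv].
  by split=> // x Ux; exact: (cvgD (cu _ Ux) (cv _ Ux)).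
split=> [x Ux|i]; first exact: (cvgD (cu _ Ux) (cv _ Ux)).
have [du pu] := hu i; have [dv pv] := hv i; split=> [x Ux|].
  by apply: derivableD; [exact: du|exact: dv].
apply: Ck_ext (IH _ _ pu pv) => x Ux.
by rewrite /partial (deriveD (du _ Ux) (dv _ Ux)).
Qed.

Lemma CkM k u v : Ck k U u -> Ck k U v -> Ck k U (fun x => u x * v x).
Proof.
elim: k u v => [|k IH] u v cku ckv.
  case: cku ckv => cu _ [cv _]; split=> // x Ux.
  exact: (cvgM (cu _ Ux) (cv _ Ux)).
have [cu hu] := cku; have [cv hv] := ckv; split=> [x Ux|i].
  exact: (cvgM (cu _ Ux) (cv _ Ux)).
have [du pu] := hu i; have [dv pv] := hv i; split=> [x Ux|].
  by apply: derivableM; [exact: du|exact: dv].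
apply: Ck_ext (CkD (IH _ _ (Ck_pred cku) pv) (IH _ _ (Ck_pred ckv) pu)).
by move=> x Ux; rewrite /partial (deriveM (du _ Ux) (dv _ Ux)).
Qed.

Lemma CkV k u : (forall x, U x -> u x != 0) -> Ck k U u ->
  Ck k U (fun x => (u x)^-1).
Proof.
move=> u0; elim: k => [|k IH] cku.
  by split=> // x Ux; exact: (cvgV (u0 _ Ux) (cku.1 _ Ux)).
have [cu hu] := cku; split=> [x Ux|i].
  exact: (cvgV (u0 _ Ux) (cu _ Ux)).
have [du pu] := hu i; split=> [x Ux|].
  by apply: derivableV; [exact: u0|exact: du].
have ckV := IH (Ck_pred cku).
apply: Ck_ext (CkM (CkM (Ck_cst k (-1)) (CkM ckV ckV)) pu) => x Ux.
by rewrite /partial (deriveV (u0 _ Ux) (du _ Ux)) /= expr2 invfM mulN1r.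
Qed.

End Smooth.

(** * Schwarz's theorem on mixed second derivatives *)

Section Schwarz.
Variables (R : realType) (n : nat).
Implicit Types (u : 'rV[R]_n -> R).

Lemma is_derive_line u (x v : 'rV[R]_n) s : derivable u (x + s *: v) v ->
  is_derive s (1 : R) (fun t : R => u (x + t *: v)) ('D_v u (x + s *: v)).
Proof.
move=> du.
have E : (fun h : R =>
    h^-1 *: (u (x + (h *: (1 : R) + s) *: v) - u (x + s *: v))) =
    (fun h : R => h^-1 *: (u (h *: v + (x + s *: v)) - u (x + s *: v))).
  apply/funext => h; congr (_ *: (u _ - _)).
  by rewrite scalerDl [h *: 1]mulr1 addrCA.
split; first by rewrite /derivable /= E.
by rewrite /derive /= E.
Qed.


(* The mean value theorem, applied twice. *)
Lemma second_difference u (x v w : 'rV[R]_n) (h : R) : 0 < h ->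
  (forall s t, 0 <= s <= h -> 0 <= t <= h ->
     derivable u (x + t *: w + s *: v) v /\
     derivable ('D_v u) (x + s *: v + t *: w) w) ->
  exists s t, [/\ 0 <= s <= h, 0 <= t <= h &
    u (x + h *: w + h *: v) - u (x + h *: v) - (u (x + h *: w) - u x) =
    'D_w ('D_v u) (x + s *: v + t *: w) * h * h].
Proof.
move=> h0 du.
have hh : 0 <= h <= h by rewrite lexx ltW.
have z0 : 0 <= (0 : R) <= h by rewrite lexx ltW.
have inI s : s \in `]0, h[%R -> 0 <= s <= h.
  by rewrite in_itv /= => /andP[/ltW -> /ltW ->].
(* The second difference is the increment of [F] over the interval from 0 to [h]; its derivative at
   the intermediate [s] is in turn an increment of [K] below. *)
pose F (s : R) := u (x + h *: w + s *: v) - u (x + s *: v).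
pose dF (s : R) := 'D_v u (x + h *: w + s *: v) - 'D_v u (x + s *: v).
have dF_ s : 0 <= s <= h -> is_derive s (1 : R) F (dF s).
  move=> sh; apply: is_deriveB; apply: is_derive_line.
    exact: (du _ _ sh hh).1.
  by have [dv _] := du _ _ sh z0; move: dv; rewrite scale0r addr0; apply.
have [|s sI FE] := @MVT R F dF 0 h h0 (fun s sI => dF_ s (inI s sI)).
  apply: derivable_within_continuous => s; rewrite in_itv /= => sI.
  by have [] := dF_ _ sI.
have sh := inI _ sI.
pose K (t : R) := 'D_v u (x + s *: v + t *: w).
pose dK (t : R) := 'D_w ('D_v u) (x + s *: v + t *: w).
have dK_ t : 0 <= t <= h -> is_derive t (1 : R) K (dK t).
  by move=> th; apply: is_derive_line; have [] := du _ _ sh th.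
have [|t tI KE] := @MVT R K dK 0 h h0 (fun t tI => dK_ t (inI t tI)).
  apply: derivable_within_continuous => t; rewrite in_itv /= => tI.
  by have [] := dK_ _ tI.
exists s, t; split; [exact: sh|exact: inI|].
move: FE; rewrite /F !scale0r !addr0 subr0 => ->.
move: KE; rewrite /K /dK /dF !scale0r !addr0 subr0 => <-.
by rewrite addrAC.
Qed.

Lemma near2_ball (U : set 'rV[R]_n) (P Q : 'rV[R]_n -> R) x (e : R) :
  open U -> U x -> 0 < e ->
  {for x, continuous P} -> {for x, continuous Q} ->
  exists2 r : R, 0 < r & forall y : 'rV[R]_n, `|x - y| < r ->
    [/\ U y, `|P x - P y| < e & `|Q x - Q y| < e].
Proof.
move=> oU Ux e0 /cvgrPdist_lt/(_ _ e0) n1 /cvgrPdist_lt/(_ _ e0) n2.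
have n3 : nbhs x U by apply: open_nbhs_nbhs.
have n4 := @filterI _ _ (nbhs_filter x) _ _ n3
  (@filterI _ _ (nbhs_filter x) _ _ n1 n2).
move/nbhs_normP: n4 => [r /= r0 rB]; exists r => // y xy.
by have [Uy [d1 d2]] := rB _ xy.
Qed.

Lemma eq_common_approx (p q : R) :
  (forall e : R, 0 < e -> exists2 m, `|p - m| < e & `|q - m| < e) -> p = q.
Proof.
move=> pq; apply/eqP; rewrite -subr_eq0 -normr_eq0; apply/eqP/le_anti.
rewrite normr_ge0 andbT; apply/ler_addgt0Pr => e e0; rewrite add0r.
have [|m pm qm] := pq (e / 2); first by rewrite divr_gt0.
rewrite [leRHS]splitr -(subrKA m).
apply: (le_trans (ler_normD _ _)); apply: lerD; first exact: ltW.
by rewrite distrC; exact: ltW.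
Qed.

(** The second difference over the parallelogram with sides [h *: v] and [h *: w] is symmetric in
    [v] and [w]. Divided by the square of [h], it is a value of either mixed derivative at some
    point near [x], and both are continuous at [x]. *)
Lemma derive_comm (U : set 'rV[R]_n) u (x v w : 'rV[R]_n) : open U -> U x ->
  (forall y, U y -> [/\ derivable u y v, derivable u y w,
     derivable ('D_v u) y w & derivable ('D_w u) y v]) ->
  {for x, continuous ('D_w ('D_v u))} -> {for x, continuous ('D_v ('D_w u))} ->
  'D_w ('D_v u) x = 'D_v ('D_w u) x.
Proof.
move=> oU Ux du c1 c2; apply: eq_common_approx => e e0.
have [r r0 rU] := near2_ball oU Ux e0 c1 c2.
(* The summand 1 keeps [M] positive when both vectors vanish; the 2 in [h] keeps the parallelogram
   strictly inside the ball. *)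
pose M := `|v| + `|w| + 1.
have M0 : 0 < M by rewrite ltr_wpDl // addr_ge0.
pose h := r / (2 * M).
have h0 : 0 < h by rewrite divr_gt0 // mulr_gt0.
have close s t : 0 <= s <= h -> 0 <= t <= h -> `|x - (x + s *: v + t *: w)| < r.
  move=> /andP[s0 sh] /andP[t0 th]; rewrite -addrA opprD addrA subrr add0r normrN.
  apply: (@le_lt_trans _ _ (h * M)).
    apply: (le_trans (ler_normD _ _)); rewrite !normrZ !ger0_norm // /M !mulrDr.
    rewrite -[leLHS]addr0 mulr1; apply: lerD; last exact: ltW.
    by apply: lerD; apply: ler_wpM2r.
  rewrite /h invfM mulrA -mulrA mulVf ?gt_eqF // mulr1.
  by rewrite ltr_pdivrMr // ltr_pMr // ltr1n.
have [|s [t [sh th E1]]] := @second_difference u x v w h h0.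
  move=> s t sh th; have [Uy _ _] := rU _ (close _ _ sh th).
  have [dv _ dvw _] := du _ Uy; split; last exact: dvw.
  by rewrite addrAC; exact: dv.
have [|t' [s' [th' sh' E2]]] := @second_difference u x w v h h0.
  move=> t' s' th' sh'; have [Uy _ _] := rU _ (close _ _ sh' th').
  have [_ dw _ dwv] := du _ Uy; split; first exact: dw.
  by rewrite addrAC; exact: dwv.
exists ('D_w ('D_v u) (x + s *: v + t *: w)).
  have [_ b _] := rU _ (close _ _ sh th); exact: b.
have -> : 'D_w ('D_v u) (x + s *: v + t *: w) =
    'D_v ('D_w u) (x + s' *: v + t' *: w).
  rewrite (addrAC x (t' *: w)) (addrAC x (h *: v)) in E2.
  have hn0 : h != 0 by rewrite gt_eqF.
  apply: (mulIf hn0); apply: (mulIf hn0); rewrite -[LHS]E1 -[RHS]E2.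
  by ring.
have [_ _ b] := rU _ (close _ _ sh' th'); exact: b.
Qed.

Lemma partial_comm (U : set 'rV[R]_n) u i j x : open U -> Ck 2 U u -> U x ->
  partial (partial u i) j x = partial (partial u j) i x.
Proof.
move=> oU [_ ck] Ux; apply: (derive_comm oU Ux).
- move=> y Uy; have [di [_ cki]] := ck i; have [dj [_ ckj]] := ck j.
  by split; [exact: di|exact: dj|exact: (cki j).1|exact: (ckj i).1].
- by have [_ [_ cki]] := ck i; exact: ((cki j).2.1 _ Ux).
- by have [_ [_ ckj]] := ck j; exact: ((ckj i).2.1 _ Ux).
Qed.

End Schwarz.

(** * Complex functions with smooth real and imaginary parts *)

Section ComplexParts.
Local Open Scope complex_scope.
Variable R : realType.
Implicit Types z w : R[i].
Lemma ReD z w : complex.Re (z + w) = complex.Re z + complex.Re w.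
Proof. by case: z w => [a b] []. Qed.
Lemma ImD z w : complex.Im (z + w) = complex.Im z + complex.Im w.
Proof. by case: z w => [a b] []. Qed.
Lemma ReM z w : complex.Re (z * w) =
  complex.Re z * complex.Re w - complex.Im z * complex.Im w.
Proof. by case: z w => [a b] []. Qed.
Lemma ImM z w : complex.Im (z * w) =
  complex.Re z * complex.Im w + complex.Im z * complex.Re w.
Proof. by case: z w => [a b] []. Qed.
Lemma ReJ z : complex.Re (conjc z) = complex.Re z. Proof. by case: z. Qed.
Lemma ImJ z : complex.Im (conjc z) = - complex.Im z. Proof. by case: z. Qed.
End ComplexParts.

Section ComplexSmooth.
Local Open Scope complex_scope.
Variables (R : realType) (n : nat) (U : set 'rV[R]_n).
Hypothesis oU : open U.
Implicit Types (u v : 'rV[R]_n -> R[i]) (p q : 'rV[R]_n -> R).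

Lemma smooth_ext p q : (forall y, U y -> p y = q y) ->
  smooth_on U p -> smooth_on U q.
Proof. by move=> pq sp k; exact: Ck_ext pq (sp k). Qed.

Lemma smooth_cst c : smooth_on U (cst c).
Proof. by move=> k; exact: Ck_cst. Qed.

Lemma smoothD p q : smooth_on U p -> smooth_on U q ->
  smooth_on U (fun x => p x + q x).
Proof. by move=> sp sq k; exact: CkD (sp k) (sq k). Qed.

Lemma smoothM p q : smooth_on U p -> smooth_on U q ->
  smooth_on U (fun x => p x * q x).
Proof. by move=> sp sq k; exact: CkM (sp k) (sq k). Qed.

Lemma smoothN p : smooth_on U p -> smooth_on U (fun x => - p x).
Proof.
move=> sp; apply: smooth_ext (smoothM (smooth_cst (-1)) sp) => y _.
by rewrite mulN1r.
Qed.

Lemma smoothV p : (forall x, U x -> p x != 0) -> smooth_on U p ->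
  smooth_on U (fun x => (p x)^-1).
Proof. by move=> p0 sp k; exact: CkV p0 (sp k). Qed.

Lemma smooth_partial p i : smooth_on U p -> smooth_on U (partial p i).
Proof. by move=> sp k; have [_ /(_ i)[]] := sp k.+1. Qed.

Lemma smooth_derivable p i x : smooth_on U p -> U x ->
  derivable p x (delta_mx 0 i).
Proof. by move=> sp Ux; have [_ /(_ i)[/(_ _ Ux)]] := sp 1. Qed.

Lemma partialD p q i x : smooth_on U p -> smooth_on U q -> U x ->
  partial (fun x => p x + q x) i x = partial p i x + partial q i x.
Proof.
move=> sp sq Ux; rewrite /partial.
by rewrite (deriveD (smooth_derivable sp Ux) (smooth_derivable sq Ux)).
Qed.

Lemma partialN p i x : smooth_on U p -> U x ->
  partial (fun x => - p x) i x = - partial p i x.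
Proof. by move=> sp Ux; rewrite /partial (deriveN (smooth_derivable sp Ux)). Qed.

Lemma partialM p q i x : smooth_on U p -> smooth_on U q -> U x ->
  partial (fun x => p x * q x) i x = partial p i x * q x + p x * partial q i x.
Proof.
move=> sp sq Ux; rewrite /partial.
rewrite (deriveM (smooth_derivable sp Ux) (smooth_derivable sq Ux)).
by rewrite addrC [q x *: _]mulrC.
Qed.

Lemma partial_ext p q i x : (forall y, U y -> p y = q y) -> U x ->
  partial p i x = partial q i x.
Proof.
move=> pq Ux; apply: near_eq_derive.
by have := near_open oU Ux; apply: filterS.
Qed.

Definition csmooth u := smooth_on U (fun x => complex.Re (u x)) /\
                        smooth_on U (fun x => complex.Im (u x)).

Lemma csmooth_ext u v : (forall y, U y -> u y = v y) -> csmooth u -> csmooth v.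
Proof.
by move=> uv [s1 s2]; split; [apply: smooth_ext s1|apply: smooth_ext s2];
  move=> y Uy; rewrite uv.
Qed.

Lemma csmooth_real p : smooth_on U p -> csmooth (fun x => (p x)%:C).
Proof. by move=> sp; split=> //; exact: smooth_cst. Qed.

Lemma csmooth_cst z : csmooth (cst z).
Proof. by split; exact: smooth_cst. Qed.

Lemma csmoothD u v : csmooth u -> csmooth v -> csmooth (fun x => u x + v x).
Proof.
move=> [su su'] [sv sv']; split.
  by apply: smooth_ext (smoothD su sv) => y _; rewrite ReD.
by apply: smooth_ext (smoothD su' sv') => y _; rewrite ImD.
Qed.

Lemma csmoothM u v : csmooth u -> csmooth v -> csmooth (fun x => u x * v x).
Proof.
move=> [su su'] [sv sv']; split.
  apply: smooth_ext (smoothD (smoothM su sv) (smoothN (smoothM su' sv'))) => y _.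
  by rewrite ReM.
apply: smooth_ext (smoothD (smoothM su sv') (smoothM su' sv)) => y _.
by rewrite ImM.
Qed.

Lemma csmoothJ u : csmooth u -> csmooth (fun x => conjc (u x)).
Proof.
move=> [s s']; split; first by apply: smooth_ext s => y _; rewrite ReJ.
by apply: smooth_ext (smoothN s') => y _; rewrite ImJ.
Qed.

Lemma csmooth_partial u i : csmooth u -> csmooth (cpartial u i).
Proof. by move=> [s s']; split; exact: smooth_partial. Qed.

Lemma cpartialD u v i x : csmooth u -> csmooth v -> U x ->
  cpartial (fun x => u x + v x) i x = cpartial u i x + cpartial v i x.
Proof.
move=> [su su'] [sv sv'] Ux; rewrite /cpartial.
under eq_fun do rewrite ReD.
under [in X in _ +i* X]eq_fun do rewrite ImD.
by rewrite !partialD.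
Qed.

Lemma cpartialM u v i x : csmooth u -> csmooth v -> U x ->
  cpartial (fun x => u x * v x) i x =
  cpartial u i x * v x + u x * cpartial v i x.
Proof.
move=> [su su'] [sv sv'] Ux; rewrite /cpartial.
under eq_fun do rewrite ReM.
under [in X in _ +i* X]eq_fun do rewrite ImM.
rewrite !partialD ?partialN ?partialM //;
  try by [apply: smoothM|apply: smoothN; apply: smoothM].
case: (u x) (v x) => [a b] [c e]; apply/eqP; rewrite eq_complex /=.
by apply/andP; split; apply/eqP; ring.
Qed.

Lemma cpartialJ u i x : csmooth u -> U x ->
  cpartial (fun x => conjc (u x)) i x = conjc (cpartial u i x).
Proof.
move=> [su su'] Ux; rewrite /cpartial.
under eq_fun do rewrite ReJ.
under [in X in _ +i* X]eq_fun do rewrite ImJ.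
by rewrite partialN.
Qed.

Lemma cpartial_cst z i x : cpartial (cst z : 'rV[R]_n -> R[i]) i x = 0.
Proof. by rewrite /cpartial /partial /= !derive_cst. Qed.

Lemma cpartial_real p i x : cpartial (fun x => (p x)%:C) i x = (partial p i x)%:C.
Proof. by rewrite /cpartial /= {2}/partial derive_cst. Qed.

Lemma cpartial_ext u v i x : (forall y, U y -> u y = v y) -> U x ->
  cpartial u i x = cpartial v i x.
Proof.
by move=> uv Ux; congr (_ +i* _); apply: partial_ext => // y Uy; rewrite uv.
Qed.

Lemma cpartial_comm u i j x : csmooth u -> U x ->
  cpartial (cpartial u i) j x = cpartial (cpartial u j) i x.
Proof.
move=> [su su'] Ux.
have E := @partial_comm R n U _ i j x oU (su 2) Ux.
have E' := @partial_comm R n U _ i j x oU (su' 2) Ux.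
exact: (f_equal2 (@Complex R) E E').
Qed.

(** The inverse is the conjugate divided by the squared modulus [p], which reduces the claim to a
    real reciprocal. *)
Lemma csmoothV u : (forall x, U x -> u x != 0) -> csmooth u ->
  csmooth (fun x => (u x)^-1).
Proof.
move=> u0 su; pose p x := complex.Re (u x) ^+ 2 + complex.Im (u x) ^+ 2.
have sp : smooth_on U p by exact: (smoothD (smoothM su.1 su.1) (smoothM su.2 su.2)).
have p0 x : U x -> p x != 0.
  move=> /u0; apply: contra; rewrite /p paddr_eq0 ?sqr_ge0 // !sqrf_eq0.
  by case: (u x) => a b /=; rewrite eq_complex.
apply: csmooth_ext (csmoothM (csmoothJ su) (csmooth_real (smoothV p0 sp))) => x Ux.
have := p0 _ Ux; rewrite /p; case: (u x) => a b /= nz.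
by apply/eqP; rewrite eq_complex /=; apply/andP; split; apply/eqP; field.
Qed.

End ComplexSmooth.

(** * The differential ring of smooth complex functions *)

Section SmoothRing.
Local Open Scope complex_scope.
Variables (R : realType) (n : nat) (U : set 'rV[R]_n) (oU : open U).

(** The openness proof is an argument so that the predicate determines the subring structure, which
    depends on it. *)
Definition smooth_pred (_ : open U) : {pred 'rV[R]_n -> R[i]} :=
  [pred u | `[< csmooth U u >]].

Lemma smooth_predP u : reflect (csmooth U u) (u \in smooth_pred oU).
Proof. by rewrite inE; exact: asboolP. Qed.

Lemma smooth_pred_subring : subring_closed (smooth_pred oU).
Proof.
split=> [|u v /smooth_predP su /smooth_predP sv|u v /smooth_predP su /smooth_predP sv];
  apply/smooth_predP.
- exact: (csmooth_cst oU).
- apply: csmooth_ext (csmoothD oU su (csmoothM oU (csmooth_cst oU (-1)) sv)) => //.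
  by move=> y _; rewrite /= mulN1r.
- exact: csmoothM.
Qed.

HB.instance Definition _ := GRing.isSubringClosed.Build _ (smooth_pred oU)
  smooth_pred_subring.

(** Elements are total functions with arbitrary values outside [U]; ring equalities must therefore
    hold there as well. *)
Record smoothfun := SmoothFun {
  sfval :> 'rV[R]_n -> R[i];
  sfvalP : sfval \in smooth_pred oU }.

HB.instance Definition _ := [isSub for sfval].
HB.instance Definition _ := [Choice of smoothfun by <:].
HB.instance Definition _ := GRing.SubChoice_isSubComPzRing.Build _ _ smoothfun
  (GRing.subringClosedP _).

Implicit Types u v : smoothfun.

Lemma smoothfunP u : csmooth U u.
Proof. exact/smooth_predP/sfvalP. Qed.

Definition mksmooth (f : 'rV[R]_n -> R[i]) (sf : csmooth U f) : smoothfun :=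
  SmoothFun (introT (smooth_predP f) sf).

Definition restr0 (f : 'rV[R]_n -> R[i]) x := if `[< U x >] then f x else 0.

Lemma restr0E f x : U x -> restr0 f x = f x.
Proof. by rewrite /restr0; case: asboolP. Qed.

Lemma csmooth_restr0 f : csmooth U f -> csmooth U (restr0 f).
Proof. by apply: csmooth_ext => // x Ux; rewrite restr0E. Qed.

(* Cut off outside U, so that the Leibniz rule and the symmetry of second
   derivatives are equalities of total functions. *)
Definition sfpartial (i : 'I_n) u : smoothfun :=
  mksmooth (csmooth_restr0 (csmooth_partial i (smoothfunP u))).

Definition sfconj u : smoothfun := mksmooth (csmoothJ oU (smoothfunP u)).

Lemma sfpartialE i u x : U x -> sfpartial i u x = cpartial u i x.
Proof. exact: restr0E. Qed.

Lemma sf_ext u v : (forall x, u x = v x) -> u = v.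
Proof. by move=> uv; apply/val_inj/funext. Qed.

Lemma sfpartial_out i u x : ~ U x -> sfpartial i u x = 0.
Proof. by rewrite /= /restr0; case: asboolP. Qed.

Lemma sfpartial_eq i u (h : smoothfun) :
  (forall x, U x -> cpartial u i x = h x) -> (forall x, ~ U x -> h x = 0) ->
  sfpartial i u = h.
Proof.
move=> hU h0; apply: sf_ext => x; have [Ux|Ux] := pselect (U x).
  by rewrite sfpartialE // hU.
by rewrite sfpartial_out // h0.
Qed.

Lemma sfM u v x : (u * v) x = u x * v x. Proof. by []. Qed.
Lemma sfD u v x : (u + v) x = u x + v x. Proof. by []. Qed.
Lemma sfB u v x : (u - v) x = u x - v x. Proof. by []. Qed.

Definition sfcst z : smoothfun := mksmooth (csmooth_cst oU z).

Lemma sfpartialM i u v :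
  sfpartial i (u * v) = sfpartial i u * v + u * sfpartial i v.
Proof.
apply: sfpartial_eq => x Ux; rewrite sfD !sfM.
  by rewrite !sfpartialE // (cpartialM oU _ (smoothfunP u) (smoothfunP v)).
by rewrite !sfpartial_out // mul0r mulr0 addr0.
Qed.

Lemma sfpartialD i u v : sfpartial i (u + v) = sfpartial i u + sfpartial i v.
Proof.
apply: sfpartial_eq => x Ux; rewrite sfD.
  by rewrite !sfpartialE // (cpartialD _ (smoothfunP u) (smoothfunP v)).
by rewrite !sfpartial_out // addr0.
Qed.

Lemma sfpartial_zmod_morphism i : zmod_morphism (sfpartial i).
Proof.
by move=> u v; apply/eqP; rewrite eq_sym subr_eq -sfpartialD subrK.
Qed.

HB.instance Definition _ i := GRing.isZmodMorphism.Build smoothfun smoothfun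
  (sfpartial i) (sfpartial_zmod_morphism i).

Lemma sfpartial_comm i j u :
  sfpartial i (sfpartial j u) = sfpartial j (sfpartial i u).
Proof.
apply: sf_ext => x; have [Ux|Ux] := pselect (U x); last first.
  by rewrite (sfpartial_out i _ Ux) (sfpartial_out j _ Ux).
have E k l : sfpartial k (sfpartial l u) x = cpartial (cpartial u l) k x.
  rewrite (sfpartialE k _ Ux).
  by apply: (cpartial_ext oU) => // y Uy; exact: sfpartialE.
rewrite !E; exact: (cpartial_comm oU j i (smoothfunP u) Ux).
Qed.

Lemma sfpartial_conj i u : sfpartial i (sfconj u) = sfconj (sfpartial i u).
Proof.
apply: sfpartial_eq => x Ux.
  by rewrite (cpartialJ _ (smoothfunP u)) //= restr0E.
rewrite [LHS](_ : _ = conjc (sfpartial i u x)) // sfpartial_out //.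
exact: conjc0.
Qed.

Lemma sfpartial_cst i z : sfpartial i (sfcst z) = 0.
Proof. by apply: sfpartial_eq => x Ux //; exact: cpartial_cst. Qed.

Lemma sfconj_zmod_morphism : zmod_morphism sfconj.
Proof. by move=> u v; apply: sf_ext => x; rewrite sfB /= rmorphB. Qed.

Lemma sfconj_monoid_morphism : monoid_morphism sfconj.
Proof.
split=> [|u v]; apply: sf_ext => x; first exact: conjc1.
by rewrite sfM -[LHS]/(conjc (u x * v x)) rmorphM.
Qed.

HB.instance Definition _ := GRing.isZmodMorphism.Build smoothfun smoothfun
  sfconj sfconj_zmod_morphism.
HB.instance Definition _ := GRing.isMonoidMorphism.Build smoothfun smoothfun
  sfconj sfconj_monoid_morphism.

(** Named so as to carry the structure of a ring morphism, which moves evaluation through sums,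
    products and matrices. *)
Definition sfeval x u : R[i] := u x.

Lemma sfeval_zmod_morphism x : zmod_morphism (sfeval x).
Proof. by []. Qed.

Lemma sfeval_monoid_morphism x : monoid_morphism (sfeval x).
Proof. by []. Qed.

HB.instance Definition _ x := GRing.isZmodMorphism.Build smoothfun R[i]
  (sfeval x) (sfeval_zmod_morphism x).
HB.instance Definition _ x := GRing.isMonoidMorphism.Build smoothfun R[i]
  (sfeval x) (sfeval_monoid_morphism x).

Lemma sfconjK : involutive sfconj.
Proof. by move=> u; apply: sf_ext => x; exact: conjcK. Qed.

Lemma sfconj_i : sfconj (sfcst 'i) = - sfcst 'i.
Proof. by apply: sf_ext => x; apply/eqP; rewrite eq_complex /= oppr0 !eqxx. Qed.

Lemma sf_add_self_eq0 u : u + u = 0 -> u = 0.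
Proof.
move=> uu; apply: sf_ext => x.
have : u x + u x = 0 by rewrite -sfD uu.
by move/eqP; rewrite -mulr2n mulrn_eq0 /= => /eqP.
Qed.

End SmoothRing.

(** * The Bochner identity in a chart *)

Lemma sum_single (V : nmodType) m (k : 'I_m) (F : 'I_m -> V) :
  (forall i, i != k -> F i = 0) -> \sum_i F i = F k.
Proof. by move=> F0; rewrite (bigD1 k) //= big1 ?addr0. Qed.

Section LocalBochner.
Local Open Scope complex_scope.
Variables (R : realType) (n : nat) (U : set 'rV[R]_n) (oU : open U).
Variables (g : 'rV[R]_n -> 'M[R]_n) (a : 'rV[R]_n -> 'rV[R]_n).
Variable f : 'rV[R]_n -> R[i].
Hypothesis g_smooth : forall i j, smooth_on U (fun x => g x i j).
Hypothesis g_sym : forall x, U x -> (g x)^T = g x.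
Hypothesis g_unit : forall x, U x -> g x \in unitmx.
Hypothesis a_smooth : forall i, smooth_on U (fun x => a x 0 i).
Hypothesis f_smooth : csmooth U f.

Local Notation A := (smoothfun oU).
Local Notation cj := (@sfconj R n U oU : {rmorphism A -> A}).
Local Notation I := (sfcst oU 'i).
Local Notation ev x := (map_mx (sfeval x)).
Local Notation cmx := (map_mx (real_complex R)).

Definition sfd (i : 'I_n) : {additive A -> A} := sfpartial i.
Local Notation d := sfd.

Lemma sfdE i u x : U x -> d i u x = cpartial u i x.
Proof. exact: sfpartialE. Qed.

Lemma sfevalE x u : (sfeval x : {rmorphism A -> R[i]}) u = u x.
Proof. by []. Qed.

Lemma sfdM i u v : d i (u * v) = d i u * v + u * d i v.
Proof. exact: sfpartialM. Qed.

Lemma ev_ext p q (X Y : 'M[A]_(p, q)) : (forall x, ev x X = ev x Y) -> X = Y.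
Proof.
move=> XY; apply/matrixP => k l; apply: sf_ext => x.
by have := congr1 (fun Z : 'M[R[i]]_(p, q) => Z k l) (XY x); rewrite !mxE.
Qed.

(* Extended by the identity matrix outside U: the elements of A are functions on
   the whole space, so that an inverse in A has to exist at every point. *)
Definition gram_ext i j x : R[i] :=
  if `[< U x >] then (g x i j)%:C else (i == j)%:R.

Lemma csmooth_gram_ext i j : csmooth U (gram_ext i j).
Proof.
apply: (csmooth_ext oU _ (csmooth_real oU (g_smooth i j))) => x Ux.
by rewrite /gram_ext asboolT.
Qed.

Definition gA : 'M[A]_n := \matrix_(i, j) mksmooth oU (csmooth_gram_ext i j).

Lemma ev_gA x : U x -> ev x gA = cmx (g x).
Proof. by move=> Ux; apply/matrixP => i j; rewrite !mxE /sfeval /= /gram_ext asboolT. Qed.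

Lemma ev_gA_out x : ~ U x -> ev x gA = 1%:M.
Proof. by move=> Ux; apply/matrixP => i j; rewrite !mxE /sfeval /= /gram_ext asboolF. Qed.

Lemma det_gA_neq0 x : (\det gA) x != 0.
Proof.
have -> : (\det gA) x = \det (ev x gA) by rewrite det_map_mx.
have [Ux|Ux] := pselect (U x); last by rewrite ev_gA_out // det1 oner_eq0.
by rewrite ev_gA // det_map_mx fmorph_eq0 -unitfE -unitmxE g_unit.
Qed.

Definition detVA : A :=
  mksmooth oU (csmoothV oU (fun x _ => det_gA_neq0 x) (smoothfunP (\det gA))).

(** Cramer's formula: only the determinant has to be inverted within the smooth functions. *)
Definition gVA : 'M[A]_n := detVA *: \adj gA.

Lemma gA_gVA : gA *m gVA = 1%:M.
Proof.
rewrite /gVA -scalemxAr mul_mx_adj scale_scalar_mx.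
rewrite (_ : detVA * \det gA = 1) //; apply: sf_ext => x.
by rewrite sfM /= mulVf // det_gA_neq0.
Qed.

Lemma ev_gVA x : U x -> ev x gVA = cmx (invmx (g x)).
Proof.
move=> Ux; have := congr1 (ev x) gA_gVA.
rewrite map_mxM map_scalar_mx rmorph1 ev_gA // => /(congr1 (mulmx (cmx (invmx (g x))))).
by rewrite mulmxA -map_mxM mulVmx ?g_unit // map_mx1 mul1mx mulmx1.
Qed.

Definition GamA i : 'M[A]_n := \matrix_(j, k) (sfcst oU (2^-1)%:C *
  \sum_l gVA k l * (d i (gA j l) + d j (gA i l) - d l (gA i j))).

Lemma d_gA x i j k : U x -> sfpartial i (gA j k) x = (partial (fun y => g y j k) i x)%:C.
Proof.
move=> Ux; rewrite sfpartialE // -cpartial_real; apply: (cpartial_ext oU) => // y Uy.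
by have := congr1 (fun X : 'M[R[i]]_n => X j k) (ev_gA Uy); rewrite !mxE.
Qed.

Lemma ev_GamA x i j k : U x -> GamA i j k x = (christoffel g i j k x)%:C.
Proof.
move=> Ux; rewrite mxE sfM /christoffel rmorphM /=; congr (_ * _).
rewrite -[LHS]/(sfeval x _) !rmorph_sum; apply: eq_bigr => l _.
rewrite rmorphM rmorphB rmorphD !sfevalE !d_gA // !rmorphM !rmorphB rmorphD /=.
congr (_ * _).
by have := congr1 (fun X : 'M[R[i]]_n => X k l) (ev_gVA Ux); rewrite !mxE.
Qed.

(** The cut-off derivations vanish outside [U], where the structure is thus that of a flat constant
    metric and the algebraic hypotheses hold too. *)
Lemma ev_GamA_out x i j k : ~ U x -> GamA i j k x = 0.
Proof.
move=> Ux; rewrite mxE sfM -[X in _ * X]/(sfeval x _) rmorph_sum big1 ?mulr0 // => l _.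
rewrite rmorphM rmorphB rmorphD !sfevalE !(sfpartial_out _ _ Ux).
by rewrite subr0 addr0 mulr0.
Qed.

Lemma gA_sym : gA^T = gA.
Proof.
apply: ev_ext => x; rewrite -map_trmx; have [Ux|Ux] := pselect (U x).
  by rewrite ev_gA // map_trmx g_sym.
by rewrite ev_gA_out // trmx1.
Qed.

Lemma gA_cj : map_mx cj gA = gA.
Proof.
apply/matrixP => i j; apply: sf_ext => x; rewrite !mxE /= /gram_ext.
by case: asboolP => _; [exact: conjc_real|exact: conjc_nat].
Qed.

Lemma GamA_cj i : map_mx cj (GamA i) = GamA i.
Proof.
apply/matrixP => j k; apply: sf_ext => x; rewrite [in LHS]mxE.
rewrite [LHS]/(conjc (GamA i j k x)).
have [Ux|Ux] := pselect (U x); first by rewrite ev_GamA //; exact: conjc_real.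
by rewrite ev_GamA_out //; exact: conjc0.
Qed.

Lemma GamA_torsion i j k : GamA i j k = GamA j i k.
Proof.
rewrite [LHS]mxE [RHS]mxE; congr (_ * _); apply: eq_bigr => l _.
have -> : gA i j = gA j i by rewrite -[in LHS]gA_sym mxE.
by rewrite [X in X - _]addrC.
Qed.

Lemma GamA_metric i :
  map_mx (d i) gA = GamA i *m gA + gA *m (GamA i)^T.
Proof.
apply/matrixP => j k; apply: sf_ext => x; rewrite mxE addmxE sfD.
rewrite [(GamA i *m _) _ _]mxE [(gA *m _) _ _]mxE.
rewrite -!(sfevalE x (\sum_l _)) !rmorph_sum -big_split.
under eq_bigr => l _ do rewrite [_^T _ _]mxE !rmorphM !sfevalE.
(* Outside [U] both sides vanish; on [U] this is the compatibility of the Christoffel symbols with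
   [g]. *)
have [Ux|Ux] := pselect (U x); last first.
  rewrite (sfpartial_out _ _ Ux) // big1 // => l _.
  by rewrite !ev_GamA_out // mul0r mulr0; exact: addr0.
rewrite d_gA // (@christoffel_metric_compatible _ _ _ x) ?g_unit //; last first.
  by have := near_open oU Ux; apply: filterS => y Uy; exact: g_sym.
rewrite rmorph_sum; apply: eq_bigr => l _.
have E p q : gA p q x = (g x p q)%:C.
  by have := congr1 (fun X : 'M[R[i]]_n => X p q) (ev_gA Ux); rewrite !mxE.
have H (p q r s : R) : (p * q + r * s)%:C = p%:C * q%:C + s%:C * r%:C.
  by rewrite rmorphD !rmorphM [X in _ + X]mulrC.
by rewrite !E !ev_GamA //; exact: H.
Qed.

Definition aA : 'rV[A]_n := \row_i mksmooth oU (csmooth_real oU (a_smooth i)).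

Lemma aA_cj : map_mx cj aA = aA.
Proof. by apply/rowP => i; apply: sf_ext => x; rewrite !mxE; exact: conjc_real. Qed.

Definition fA : A := mksmooth oU f_smooth.

(** * Transfer of the geometric operators to the ring *)

Local Notation Gam := GamA.
Local Notation const v := (map_mx (sfcst oU) (v : 'rV[R[i]]_n)).

(** Agreement on [U] alone is asked for: [U] being open, it is preserved by differentiation and so
    passes through every operator. *)
Definition rep u (uh : A) := forall x, U x -> u x = uh x.
Definition repv X (Xh : 'rV[A]_n) := forall x, U x -> X x = ev x Xh.

Lemma evE p q x (X : 'M[A]_(p, q)) k l : ev x X k l = X k l x.
Proof. exact: mxE. Qed.

Lemma rep_entry X Xh k : repv X Xh -> rep (fun y => X y 0 k) (Xh 0 k).
Proof. by move=> rX x Ux; rewrite rX // evE. Qed.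

Lemma rep_cpartial u uh i x : rep u uh -> U x -> cpartial u i x = d i uh x.
Proof. by move=> ru Ux; rewrite sfdE //; exact: (cpartial_ext oU). Qed.

Lemma sf_sum (I : Type) (r : seq I) (P : pred I) (F : I -> A) x :
  (\sum_(i <- r | P i) F i) x = \sum_(i <- r | P i) F i x.
Proof. by rewrite -sfevalE rmorph_sum. Qed.

Lemma repv_const v : repv (cst v) (const v).
Proof. by move=> x _; apply/rowP => k; rewrite !mxE. Qed.

Lemma dclosed_const v : dclosed d (const v).
Proof. by move=> i; apply/rowP => k; rewrite !mxE; exact: sfpartial_cst. Qed.

Lemma rep_deriv_along X Xh u uh : repv X Xh -> rep u uh ->
  rep (deriv_along X u) (aderiv d Xh uh).
Proof.
move=> rX ru x Ux; rewrite /aderiv sf_sum; apply: eq_bigr => i _.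
by rewrite sfM rX // evE (rep_cpartial _ ru).
Qed.

Lemma rep_pairing w wh X Xh : repv w wh -> repv X Xh ->
  rep (pairing w X) (adot wh Xh).
Proof.
move=> rw rX x Ux; rewrite adotE sf_sum; apply: eq_bigr => i _.
by rewrite sfM rX // rw // !evE.
Qed.

Lemma repv_lie X Xh Y Yh : repv X Xh -> repv Y Yh ->
  repv (lie X Y) (alie d Xh Yh).
Proof.
move=> rX rY x Ux; apply/rowP => k; rewrite evE mxE [alie _ _ _ _ _]mxE sfB.
by rewrite (rep_deriv_along rX (rep_entry k rY)) //
  (rep_deriv_along rY (rep_entry k rX)).
Qed.

Lemma repv_potential : repv (potential a) aA.
Proof. by move=> x _; apply/rowP => k; rewrite !mxE. Qed.

Lemma rep_ext_d X Xh Y Yh : repv X Xh -> repv Y Yh ->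
  rep (ext_d (potential a) X Y) (aext d aA Xh Yh).
Proof.
move=> rX rY x Ux; rewrite /ext_d /aext !sfB.
rewrite (rep_deriv_along rX (rep_pairing repv_potential rY)) //.
rewrite (rep_deriv_along rY (rep_pairing repv_potential rX)) //.
by rewrite (rep_pairing repv_potential (repv_lie rX rY)).
Qed.

Lemma repv_nabla X Xh Y Yh : repv X Xh -> repv Y Yh ->
  repv (nabla g Y X) (anabla d Gam Yh Xh).
Proof.
move=> rX rY x Ux; apply/rowP => k; rewrite evE mxE /anabla summxE sf_sum.
rewrite (rep_deriv_along rY (rep_entry k rX)) // /aderiv sf_sum -big_split.
apply: eq_bigr => i _; rewrite scalemxE /acov addmxE !sfM sfD map_mxE mulrDr.
congr (_ + _); rewrite mxE sf_sum mulr_sumr; apply: eq_bigr => j _.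
by rewrite sfM ev_GamA // rX // rY // !evE -mulrA mulrC mulrA.
Qed.

Lemma ev_anabla_frame k X x :
  ev x (anabla d Gam (const (delta_mx 0 k)) X) = ev x (acov d Gam k X).
Proof.
apply/rowP => l; rewrite !evE /anabla summxE sf_sum (sum_single (k := k)).
  by rewrite scalemxE sfM !mxE !eqxx mul1r.
by move=> i ik; rewrite scalemxE sfM !mxE (negbTE ik) andbF mul0r.
Qed.

Lemma rep_divergence X Xh : repv X Xh -> rep (divergence g X) (adiv d Gam Xh).
Proof.
move=> rX x Ux; rewrite /adiv sf_sum; apply: eq_bigr => k _.
by rewrite (repv_nabla rX (repv_const _)) // ev_anabla_frame evE.
Qed.

Lemma repv_differential u uh : rep u uh -> repv (differential u) (adiff d uh).
Proof.
move=> ru x Ux; apply/rowP => k; rewrite evE mxE [adiff _ _ _ _]mxE.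
exact: rep_cpartial.
Qed.

Lemma sharp_ev x w : U x -> sharp g x (ev x w) = ev x (w *m gVA).
Proof.
move=> Ux; apply/rowP => k; rewrite evE mxE [(w *m _) _ _]mxE sf_sum.
apply: eq_bigr => j _; rewrite evE sfM mulrC; congr (_ * _).
have -> : gVA j k = gVA k j by rewrite -[in LHS](gi_sym gA_gVA gA_sym) mxE.
by have := congr1 (fun X : 'M[R[i]]_n => X k j) (ev_gVA Ux); rewrite !mxE.
Qed.

Lemma ev_conjv x (X : 'rV[A]_n) : conjv (ev x X) = ev x (map_mx cj X).
Proof. by apply/rowP => k; rewrite !mxE. Qed.

Lemma hinner_ev x (X Y : 'rV[A]_n) : U x -> hinner g x (ev x X) (ev x Y) = ah cj gA X Y x.
Proof.
have -> : ah cj gA X Y = \sum_j (\sum_i X 0 i * gA i j) * cj (Y 0 j).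
  by rewrite /ah mxE; apply: eq_bigr => j _; rewrite mxE; congr (_ * _); rewrite !mxE.
move=> Ux; rewrite /hinner exchange_big sf_sum; apply: eq_bigr => j _.
rewrite sfM sf_sum mulr_suml; apply: eq_bigr => i _; rewrite sfM !evE.
rewrite (_ : (g x i j)%:C = gA i j x); first by rewrite [gA i j x * _]mulrC.
by have := congr1 (fun X : 'M[R[i]]_n => X i j) (ev_gA Ux); rewrite !mxE.
Qed.

Lemma repv_gradA u uh : rep u uh -> repv (gradA g a u) (agradA d I gVA aA uh).
Proof.
move=> ru x Ux; rewrite /gradA /agradA -sharp_ev //; congr (sharp g x _).
rewrite /differentialA (repv_differential ru) // repv_potential // ru //.
by apply/rowP => k; rewrite !mxE.
Qed.

Lemma sfN (u : A) x : (- u) x = - u x. Proof. by []. Qed.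

Lemma repv_grad u uh : rep u uh -> repv (grad g u) (adiff d uh *m gVA).
Proof.
by move=> ru x Ux; rewrite /grad (repv_differential ru Ux) (sharp_ev _ Ux).
Qed.

Lemma rep_laplace u uh : rep u uh -> rep (laplace g u) (alap d gVA Gam uh).
Proof.
move=> ru x Ux.
by rewrite /laplace (rep_divergence (repv_grad ru) Ux) /alap sfN.
Qed.

Lemma rep_laplaceA u uh : rep u uh ->
  rep (laplaceA g a u) (alapA d I gVA Gam aA uh).
Proof.
move=> ru x Ux; have rG := repv_gradA ru.
rewrite /laplaceA /divergenceA (rep_divergence rG Ux) (rG x Ux).
rewrite (repv_potential Ux) (sharp_ev _ Ux) (hinner_ev _ _ Ux).
rewrite (ah_sharp gA_gVA gA_sym gA_cj) aA_cj.
by rewrite /alapA /adivA sfN sfD sfM.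
Qed.

(** If [E] has the basis vectors as rows, orthonormality reads [E *m g x *m E^T = 1%:M], so
    [E^T *m E] is the inverse of [g x]. *)
Lemma orthonormal_invmx x (e : 'I_n -> 'rV[R]_n) i k :
  orthonormal_basis g x e -> \sum_j e j 0 i * e j 0 k = invmx (g x) i k.
Proof.
move=> e_on; pose E : 'M[R]_n := \matrix_(j, l) e j 0 l.
have EgE : E *m g x *m E^T = 1%:M.
  apply/matrixP => p q; rewrite [RHS]mxE -e_on !mxE; apply: eq_bigr => l _.
  rewrite !mxE; congr (_ * _); apply: eq_bigr => m _; by rewrite mxE.
have gE : g x *m (E^T *m E) = 1%:M.
  by rewrite mulmxA; apply: mulmx1C; rewrite mulmxA.
have [gU _] := mulmx1_unit gE.
rewrite -[invmx (g x)]mulmx1 -gE (mulmxA (invmx _)) mulVmx // mul1mx mxE.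
by apply: eq_bigr => j _; rewrite !mxE.
Qed.

Lemma gVA_onb x (e : 'I_n -> 'rV[R]_n) i k : U x -> orthonormal_basis g x e ->
  gVA i k x = \sum_j (e j 0 i)%:C * (e j 0 k)%:C.
Proof.
move=> Ux e_on.
have -> : gVA i k x = (invmx (g x) i k)%:C.
  by have := congr1 (fun X : 'M[R[i]]_n => X i k) (ev_gVA Ux); rewrite !mxE.
rewrite -(orthonormal_invmx i k e_on) rmorph_sum.
by apply: eq_bigr => j _; rewrite rmorphM.
Qed.

Local Notation GA := (agradA d I gVA aA fA).

Lemma rep_fA : rep f fA. Proof. by []. Qed.

Lemma repv_nablaA X Xh Y Yh : repv X Xh -> repv Y Yh ->
  repv (nablaA g a Y X) (\sum_i Yh 0 i *: acovA d I Gam aA i Xh).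
Proof.
move=> rX rY x Ux; rewrite -anablaA /nablaA (repv_nabla rX rY Ux) (rX x Ux).
rewrite (rep_pairing repv_potential rY Ux); apply/rowP => k.
move: (anabla _ _ _ _) (adot _ _) => V c.
by rewrite evE !addmxE !scalemxE !evE sfD !sfM.
Qed.

(** The basis enters only through the sums of [gVA_onb]; its vectors are real, so conjugation leaves
    their components unchanged. *)
Lemma normsq_hessA_ev x e : U x -> orthonormal_basis g x e ->
  normsq_hessA g a e f x =
  (\sum_i \sum_j gVA i j * ah cj gA (acovA d I Gam aA i GA)
                                    (acovA d I Gam aA j GA)) x.
Proof.
move=> Ux e_on; pose h i k := ah cj gA (acovA d I Gam aA i GA) (acovA d I Gam aA k GA).
have E i : (\sum_k gVA i k * h i k) x =
    \sum_j \sum_k (e j 0 i)%:C * (e j 0 k)%:C * h i k x.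
  rewrite sf_sum exchange_big; apply: eq_bigr => k _.
  by rewrite sfM (gVA_onb i k Ux e_on) mulr_suml.
rewrite -/(h _ _) sf_sum (eq_bigr _ (fun i _ => E i)) exchange_big.
apply: eq_bigr => j _.
rewrite /normsq (repv_nablaA (repv_gradA rep_fA) (repv_const _) Ux).
rewrite (hinner_ev _ _ Ux) ah_sum sf_sum; apply: eq_bigr => i _.
rewrite sf_sum; apply: eq_bigr => k _; rewrite !sfM; congr (_ * _ * _).
  by rewrite !mxE.
by rewrite !mxE; exact: conjc_real.
Qed.

Lemma repv_curvature X Xh Y Yh Z Zh : repv X Xh -> repv Y Yh -> repv Z Zh ->
  repv (curvature g X Y Z) (acurv d Gam Xh Yh Zh).
Proof.
move=> rX rY rZ x Ux; rewrite /curvature /acurv.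
rewrite (repv_nabla (repv_nabla rZ rY) rX Ux) (repv_nabla (repv_nabla rZ rX) rY Ux).
rewrite (repv_nabla rZ (repv_lie rX rY) Ux).
move: (anabla _ _ _ _) (anabla _ _ _ _) (anabla _ _ _ _) => V W T.
by rewrite !map_mxB.
Qed.

(** All three fields in the definition of [ricci] have constant components, so [acurvE] applies; the
    trace selects the [k]-th frame field. *)
Lemma ricci_ev x X Y : U x ->
  ricci g x (ev x X) (ev x Y) = aric d Gam X (map_mx cj Y) x.
Proof.
move=> Ux; rewrite /ricci /aric sf_sum; apply: eq_bigr => k _.
rewrite (repv_curvature (repv_const _) (repv_const _) (repv_const _) Ux) evE.
rewrite (acurvE sfdM _ (@dclosed_const _) (@dclosed_const _) (@dclosed_const _)).
have gen (V : 'I_n -> 'I_n -> 'rV[A]_n) v :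
    (\sum_i \sum_j (const (delta_mx 0 k) 0 i * const v 0 j) *: V i j) 0 k x =
    \sum_j v 0 j * V k j 0 k x.
  rewrite summxE sf_sum (sum_single (k := k)) => [|i ik].
    rewrite summxE sf_sum; apply: eq_bigr => j _.
    by rewrite scalemxE !sfM !mxE !eqxx mul1r.
  rewrite summxE sf_sum big1 // => j _.
  by rewrite scalemxE !sfM !mxE (negbTE ik) andbF !mul0r.
rewrite gen sf_sum; apply: eq_bigr => j _; rewrite sfM evE; congr (_ * _).
have entry w : (w *m aR d Gam k j) 0 k x = \sum_l w 0 l x * aR d Gam k j l k x.
  by rewrite mxE sf_sum.
rewrite !entry; apply: eq_bigr => l _; congr (_ * _).
by rewrite !mxE.
Qed.

Lemma rep_nabla_ext_d Z Zh X Xh Y Yh : repv Z Zh -> repv X Xh -> repv Y Yh ->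
  rep (nabla_ext_d g (potential a) Z X Y) (anabla_ext d Gam aA Zh Xh Yh).
Proof.
move=> rZ rX rY x Ux; rewrite /nabla_ext_d /anabla_ext.
rewrite (rep_deriv_along rZ (rep_ext_d rX rY) Ux).
rewrite (rep_ext_d (repv_nabla rX rZ) rY Ux).
rewrite (rep_ext_d rX (repv_nabla rY rZ) Ux).
move: (aderiv _ _ _) => u; move: (aext _ _ _ _) => v.
by move: (aext _ _ _ _) => w; rewrite !sfB.
Qed.

(** As for the Hessian, [gVA_onb] turns the sum over the basis into a contraction with the inverse
    metric, here of the tensor given by [anabla_extE]. *)
Lemma codiff_ev x e : U x -> orthonormal_basis g x e ->
  codiff_ext_d g e (potential a) x = ev x (adelta d gVA Gam aA).
Proof.
move=> Ux e_on; apply/rowP => k; rewrite evE mxE [adelta _ _ _ _ _ _]mxE sfN.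
congr (- _); rewrite sf_sum.
have E i : (gVA *m acov2 d Gam i (aB d aA)) i k x =
    \sum_j \sum_l (e j 0 i)%:C * (e j 0 l)%:C * acov2 d Gam i (aB d aA) l k x.
  rewrite mxE sf_sum exchange_big; apply: eq_bigr => l _.
  by rewrite sfM (gVA_onb i l Ux e_on) mulr_suml.
rewrite (eq_bigr _ (fun i _ => E i)) exchange_big; apply: eq_bigr => j _.
rewrite (rep_nabla_ext_d (repv_const _) (repv_const _) (repv_const _) Ux).
rewrite (anabla_extE sfdM _ _ _ (@dclosed_const _) (@dclosed_const _)).
rewrite sf_sum; apply: eq_bigr => i _.
rewrite sfM adotE sf_sum (sum_single (k := k)) => [|l lk]; last first.
  by rewrite sfM !mxE (negbTE lk) andbF mulr0.
move: (acov2 _ _ _ _) => K; rewrite sfM [(_ *m K) _ _]mxE sf_sum.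
rewrite mulr_suml mulr_sumr.
by apply: eq_bigr => l _; rewrite sfM !mxE !eqxx mulr1 mulrA.
Qed.

Theorem local_bochner x (e e' : 'I_n -> 'rV[R]_n) : U x ->
  orthonormal_basis g x e -> orthonormal_basis g x e' ->
  let G := gradA g a f in
  let Gbar := fun y => conjv (G y) in
  let GL := gradA g a (laplaceA g a f) in
  let delta_da := sharp g x (codiff_ext_d g e' (potential a) x) in
  - 2^-1 * laplace g (fun y => normsq g y (G y)) x =
    normsq_hessA g a e f x
    - 2^-1 * (hinner g x (G x) (GL x) + hinner g x (GL x) (G x))
    + ricci g x (G x) (G x)
    + 'i%C * (ext_d (potential a) G Gbar x - ext_d (potential a) Gbar G x)
    + 'i%C / 2 * (hinner g x (conjc (f x) *: G x) delta_da
                  - hinner g x (f x *: Gbar x) delta_da).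
Proof.
move=> Ux e_on e'_on G Gbar GL delta_da.
have rG : repv G GA := repv_gradA rep_fA.
have rGbar : repv Gbar (map_mx cj GA) by move=> y Uy; rewrite /Gbar (rG y Uy) ev_conjv.
pose GLA := agradA d I gVA aA (alapA d I gVA Gam aA fA).
have rGL : repv GL GLA.
  exact: repv_gradA (rep_laplaceA rep_fA).
have rN : rep (fun y => normsq g y (G y)) (ah cj gA GA GA).
  by move=> y Uy; rewrite /normsq (rG y Uy) (hinner_ev _ _ Uy).
have cjd i (u : A) : d i (cj u) = cj (d i u) := sfpartial_conj i u.
(* The 1-form [adelta] is real, so the conjugation in the second slot of [hinner] leaves it
   unchanged. *)
have hdelta (c : A) (V : 'rV[A]_n) : hinner g x (c x *: ev x V) delta_da =
    (c * adot (adelta d gVA Gam aA) V) x.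
  have -> : c x *: ev x V = ev x (c *: V).
    by apply/rowP => k; rewrite scalemxE !evE scalemxE sfM.
  rewrite /delta_da (codiff_ev Ux e'_on) (sharp_ev _ Ux) (hinner_ev _ _ Ux).
  rewrite (ah_sharp gA_gVA gA_sym gA_cj).
  rewrite (adelta_cj cjd gA_gVA gA_cj aA_cj GamA_cj).
  by rewrite adotZ adotC.
(* The algebraic identity is halved only after evaluation at [x], in the complex field. *)
have half (L S p q r b b' s s' : A) :
    - L = 2 * S - (p + q) + 2 * r + 2 * I * (b - b') + I * (s - s') ->
    - 2^-1 * L x = S x - 2^-1 * (p x + q x) + r x + 'i%C * (b x - b' x)
                   + 'i%C / 2 * (s x - s' x).
  move=> /(congr1 (fun u : A => u x)).
  have two : (2 : A) x = 2 by rewrite -sfevalE rmorph_nat.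
  rewrite !(two, sfM, sfD, sfN) -[I x]/('i%C).
  move: (L x) (S x) (p x) (q x) (r x) (b x) (b' x) (s x) (s' x).
  move=> L0 S0 p0 q0 r0 b0 b0' s0 s0' E.
  by rewrite mulNr -mulrN E; field.
have := magnetic_bochner_algebra sfdM (@sfpartial_comm _ _ _ oU) cjd
  (fun i => @sfpartial_cst _ _ _ oU i 'i) (@sfconjK _ _ _ oU) (sfconj_i oU)
  (@sf_add_self_eq0 _ _ _ oU) gA_gVA gA_sym gA_cj aA_cj GamA_cj GamA_torsion
  GamA_metric fA.
clearbody G Gbar GL delta_da; rewrite -/GLA; move: GLA rGL => GLA rGL /half E.
rewrite (normsq_hessA_ev Ux e_on) (rep_laplace rN Ux).
rewrite (rep_ext_d rG rGbar Ux) (rep_ext_d rGbar rG Ux) !(aextE sfdM).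
rewrite (rG x Ux) (rGbar x Ux) -[conjc (f x)]/(cj fA x) -[f x]/(fA x) !hdelta.
rewrite (rGL x Ux) !(hinner_ev _ _ Ux) (ricci_ev _ _ Ux).
exact: E.
Qed.

End LocalBochner.

(** * The identity at a point of the manifold, read in a chart *)

Theorem theorem4p1 (R : realType) (n : nat) (M : manifold R n)
    (metric : riemannian_metric M) (alpha : one_form M)
    (M_connected : connected [set: M])
    (M_complete : geodesically_complete metric)
    (F : M -> R[i]%C) (F_smooth : smooth_fun F)
    (c : chart R n M) (c_atlas : atlas c) (p : M) (p_dom : cdom c p)
    (e e' : 'I_n -> 'rV[R]_n)
    (e_on : orthonormal_basis (gram metric c) (cmap c p) e)
    (e'_on : orthonormal_basis (gram metric c) (cmap c p) e') :
  let x := cmap c p in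
  let g := gram metric c in
  let a := coef alpha c in
  let f := incoord c F in
  let G := gradA g a f in
  let Gbar := fun y => conjv (G y) in
  let GL := gradA g a (laplaceA g a f) in
  let delta_da := sharp g x (codiff_ext_d g e' (potential a) x) in
  - 2^-1 * laplace g (fun y => normsq g y (G y)) x =
    normsq_hessA g a e f x
    - 2^-1 * (hinner g x (G x) (GL x) + hinner g x (GL x) (G x))
    + ricci g x (G x) (G x)
    + 'i%C * (ext_d (potential a) G Gbar x - ext_d (potential a) Gbar G x)
    + 'i%C / 2 * (hinner g x (conjc (f x) *: G x) delta_da
                  - hinner g x (f x *: Gbar x) delta_da).
Proof.
have g_unit y : cimg c y -> gram metric c y \in unitmx.
  by move=> cy; apply: posdef_unitmx; exact: gram_posdef.
have [f_re f_im] := F_smooth c c_atlas.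
have cx : cimg c (cmap c p) by exists p.
move=> x g a f; exact: (local_bochner (@open_cimg _ _ _ c)
  (gram_smooth metric c_atlas) (gram_sym metric c_atlas) g_unit
  (coef_smooth alpha c_atlas) (conj f_re f_im) cx e_on e'_on).
Qed.
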